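(* Let $\Bbbk$ be a field, let $n\ge 1$, let $P_n$ be the path on vertices $x_1,\dots,x_n$ with edges $\{x_i,x_{i+1}\}$ for $1\le i\le n-1$, and let $\mathcal C$ be a maximal (with respect to inclusion) independent set of $P_n$. Let $R=\Bbbk[x_1,\dots,x_n]$, $S=R[z]$, and let $G=P_n(\mathcal C)$ be the $\mathcal C$-suspension of $P_n$ with new vertex $z$. Then $$\operatorname{reg} S/I(G)=\operatorname{reg} R/I(P_n),$$ except when $n=3k+1$ for some integer $k\ge 0$ and $\mathcal C=\{x_1,x_4,\dots,x_{3k+1}\}$; in this exceptional case $$\operatorname{reg} S/I(G)=\operatorname{reg} R/I(P_n)+1.$$
   Context: For a finite simple graph $H$ whose vertices are identified with the variables of a polynomial ring over $\Bbbk$, the edge ideal $I(H)$ is the ideal generated by the products $uv$ over all edges $\{u,v\}$ of $H$. An independent set is a set of pairwise non-adjacent vertices. For a graph $H$ and $\mathcal C\subseteq V(H)$, the $\mathcal C$-suspension $H(\mathcal C)$ is obtained from $H$ by adjoining a new vertex $z$ joined to every vertex of $\mathcal C$ and to no other vertices; thus $I(G)=I(P_n)+(zx_i:x_i\in\mathcal C)\subseteq S$. For a finitely generated graded module $M$ over a standard graded polynomial ring with graded Betti numbers $\beta_{i,j}(M)$, $\operatorname{reg} M=\max\{j-i:\beta_{i,j}(M)\neq 0\}$. *)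

(* Defs.v *)
From Stdlib Require Import ClassicalEpsilon.
From mathcomp Require Import all_boot all_order all_algebra.
From mathcomp Require Import mpoly.
Set Implicit Arguments.
Unset Strict Implicit.
Unset Printing Implicit Defensive.
Import Order.TTheory GRing.Theory Num.Theory.
Local Open Scope ring_scope.

Section Graphs.

Definition independent (n : nat) (e : rel 'I_n) (A : {set 'I_n}) : bool :=
  [forall x in A, forall y in A, ~~ e x y].

(* The vertex x_{i+1} is the ordinal i. *)
Definition path_graph (n : nat) : rel 'I_n :=
  fun i j => (j == i.+1 :> nat) || (i == j.+1 :> nat).

(* The new vertex z is [ord_max : 'I_n.+1]; the old vertex i is
   [lift ord_max i], which has the same value as i. *)
Definition suspension (n : nat) (e : rel 'I_n) (C : {set 'I_n}) :
    rel 'I_n.+1 :=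
  fun u v => match unlift ord_max u, unlift ord_max v with
             | Some i, Some j => e i j
             | Some i, None => i \in C
             | None, Some j => j \in C
             | None, None => false
             end.

End Graphs.

Section Regularity.

Variables (k : fieldType) (n : nat).
Local Notation S := {mpoly k[n]}.

Definition edge_ideal (e : rel 'I_n) (p : S) : Prop :=
  exists c : 'I_n -> 'I_n -> S,
    p = \sum_(i < n) \sum_(j < n | e i j) c i j * ('X_i * 'X_j).

(* [homog_diff p a b] : p = 0, or p is homogeneous of degree a - b computed in
   the integers; in particular p = 0 when a < b. *)
Definition homog_diff (p : S) (a b : nat) : Prop :=
  forall m : 'X_{1..n}, m \in msupp p -> (mdeg m + b = a)%N.

(* Data of graded free modules F_i = \bigoplus_a S(- fgdeg a) with finite
   bases, maps fdiff i : F_{i+1} -> F_i, and an augmentation from F_0 to a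
   cyclic module S/I. Elements of F_i are row vectors and maps act by right
   multiplication; faug lists representatives in S of the images in S/I of the
   basis of F_0. *)
Record free_complex := FreeComplex {
  frank : nat -> nat;
  fgdeg : forall i, 'I_(frank i) -> nat;
  fdiff : forall i, 'M[S]_(frank i.+1, frank i);
  faug : 'cV[S]_(frank 0)
}.

Definition aug_val (F : free_complex) (v : 'rV[S]_(frank F 0)) : S :=
  (v *m faug F) 0 0.

Definition graded_complex (F : free_complex) : Prop :=
  (forall i a b, homog_diff (fdiff F i a b) (fgdeg a) (fgdeg b)) /\
  (forall a, homog_diff (faug F a 0) (fgdeg a) 0).

(* Exactness of ... -> F_1 -> F_0 -> S/I -> 0. *)
Definition resolves (I : S -> Prop) (F : free_complex) : Prop :=
  [/\ forall p : S, exists v : 'rV[S]_(frank F 0), I (p - aug_val v),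
      forall v : 'rV[S]_(frank F 0),
        I (aug_val v) <-> exists w, v = w *m fdiff F 0
    & forall i (v : 'rV[S]_(frank F i.+1)),
        v *m fdiff F i = 0 <-> exists w, v = w *m fdiff F i.+1].

(* The image of F_{i+1} lies in (X_0, ..., X_{n-1}) F_i. *)
Definition minimal_complex (F : free_complex) : Prop :=
  forall i a b, (fdiff F i a b)@_0%MM = 0.

Definition minimal_graded_free_resolution (I : S -> Prop)
    (F : free_complex) : Prop :=
  [/\ graded_complex F, resolves I F & minimal_complex F].

(* The graded Betti numbers of S/I: the number of summands S(-j) in F_i, for F
   a minimal graded free resolution of S/I. For I a homogeneous ideal such an F
   exists and the number does not depend on it. *)
Definition betti (I : S -> Prop) (i j : nat) : nat :=
  epsilon (inhabits 0%N) (fun b => exists F : free_complex,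
    minimal_graded_free_resolution I F /\
    b = #|[set a : 'I_(frank F i) | fgdeg a == j]|).

Definition is_reg (I : S -> Prop) (r : int) : Prop :=
  (exists i j : nat, betti I i j <> 0%N /\ j%:Z - i%:Z = r) /\
  (forall i j : nat, betti I i j <> 0%N -> j%:Z - i%:Z <= r).

(* reg (S/I), the maximum of the j - i with nonzero betti I i j. *)
Definition reg_quotient (I : S -> Prop) : int :=
  epsilon (inhabits (0 : int)) (is_reg I).

End Regularity.

(* n = 3k+1 and C = {x_1, x_4, ..., x_{3k+1}}; x_{i+1} is the ordinal i. *)
Definition exceptional (n : nat) (C : {set 'I_n}) : Prop :=
  exists k : nat, n = (3 * k + 1)%N /\ C = [set i : 'I_n | (3 %| i)%N].

(* Main.v *)
(* All ideals involved are I(H) + (variables in V) for a graph H, and for a vertex x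
   outside V both (I : x) and I + (x) are again of this form: the first adds the
   neighbours of x to V, the second adds x.  From free resolutions of S/(I : x)(-1) and
   S/(I, x) the horseshoe lemma gives one of S/I.  It need not be minimal, but a basis
   element whose row and column in the differentials contain no unit still contributes
   to Tor, and hence to every minimal resolution.  Keeping track of such an element in
   the corner (length, regularity) gives, by induction, reg R/I(P_n) = floor((n+1)/3)
   with projective dimension floor(2n/3).

   For the suspension one takes x = z: the ideal (I(G) : z) consists of the variables in C
   and the edges of P_n - C, which form a matching with g edges, while (I(G), z) is
   I(P_n) plus a variable.  Maximality of C gives 3g + 2 <= n, hence
   g < floor((n+1)/3), except when n = 3g + 1 and C = {x_1, x_4, ...}.  In the first
   case the corner of P_n has degree too large to be cancelled; in the exceptional case
   the corner of the colon ideal sits in the top homological position and survives. *)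

Require Import Defs.
From Stdlib Require Import ClassicalEpsilon.
From HB Require Import structures.
From mathcomp Require Import all_boot all_order all_algebra.
From mathcomp Require Import mpoly.
From mathcomp Require Import zify.
Set Implicit Arguments.
Unset Strict Implicit.
Unset Printing Implicit Defensive.
Import Order.TTheory GRing.Theory Num.Theory.
Local Open Scope ring_scope.

(** * Homogeneous components and graded lifts *)

(** Used to build chain maps, homotopies and connecting maps one position at a time. Each state is a
    related pair, since the relation for the last two terms is what allows the next one to be
    chosen. *)
Lemma dependent_choice2 (T : nat -> Type) (R : forall i, T i -> T i.+1 -> Prop)
    (x : T 0) :
  (exists y, R 0 x y) ->
  (forall i x y, R i x y -> exists z, R i.+1 y z) ->
  exists f : forall i, T i, f 0 = x /\ forall i, R i (f i) (f i.+1).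
Proof.
move=> h0 hS.
pose U i := {p : T i * T i.+1 | R i p.1 p.2}.
have u0 : {y | R 0 x y} by apply: constructive_indefinite_description.
pose s0 : U 0 := exist (fun p => R 0 p.1 p.2) (x, sval u0) (svalP u0).
have step i (u : U i) : {z | R i.+1 (sval u).2 z}.
  by apply: constructive_indefinite_description; apply: hS (svalP u).
pose next i (u : U i) : U i.+1 :=
  exist (fun p => R i.+1 p.1 p.2) ((sval u).2, sval (step i u)) (svalP (step i u)).
pose g := fix g i : U i := match i with 0 => s0 | j.+1 => next j (g j) end.
exists (fun i => (sval (g i)).1); split=> // i.
exact: (svalP (g i)).
Qed.

Section HomogeneousComponents.

Variables (k : fieldType) (n : nat).
Local Notation S := {mpoly k[n]}.

(** The component of degree a - b, the difference being taken in the integers: the test guards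
    against truncated subtraction, as in [homog_diff]. *)
Definition hcomp (a b : nat) (p : S) : S :=
  if (b <= a)%N then pihomog mdeg (a - b) p else 0.

Lemma hcomp_is_linear a b : linear (hcomp a b).
Proof.
move=> c p q; rewrite /hcomp; case: ifP => _; first exact: linearP.
by rewrite scaler0 addr0.
Qed.

HB.instance Definition _ a b :=
  GRing.isLinear.Build k S S _ (hcomp a b) (hcomp_is_linear a b).

Lemma hcompX a b m :
  hcomp a b 'X_[m] = if (mdeg m + b == a)%N then 'X_[m] else 0.
Proof.
rewrite /hcomp; case: leqP => hab.
  rewrite pihomogX; congr (if _ then _ else _).
  by apply/eqP/eqP => [->|<-]; [exact: subnK | rewrite addnK].
by case: eqP => // e; move: hab; rewrite -e ltnNge leq_addl.
Qed.

Lemma mcoeff_hcomp a b p m :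
  (hcomp a b p)@_m = if (mdeg m + b == a)%N then p@_m else 0.
Proof.
rewrite {1 2}[p]mpolyE !linear_sum /=.
have E i : (hcomp a b (p@_i *: 'X_[i]))@_m =
    if (mdeg m + b == a)%N then (p@_i *: 'X_[i])@_m else 0.
  rewrite linearZ /= hcompX !mcoeffZ mcoeffX.
  case: (i =P m) => [->|/eqP ne]; first case: ifP => _.
  - by rewrite mcoeffX eqxx.
  - by rewrite mcoeff0 mulr0.
  case: ifP => _; last by rewrite mcoeff0 mulr0 if_same.
  by rewrite mcoeffX (negPf ne) mulr0 if_same.
rewrite (eq_bigr _ (fun i _ => E i)).
by case: ifP => _ //; rewrite big1.
Qed.

Lemma homog_diffP a b (p : S) : homog_diff p a b <-> hcomp a b p = p.
Proof.
split=> [h|h m].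
  apply/mpolyP => m; rewrite mcoeff_hcomp; case: eqP => // ne.
  by apply/esym/memN_msupp_eq0/negP => /h.
by rewrite mcoeff_msupp -h mcoeff_hcomp; case: (_ =P a) => // _; rewrite eqxx.
Qed.

Lemma homog_hcomp a b p : homog_diff (hcomp a b p) a b.
Proof.
by move=> m; rewrite mcoeff_msupp mcoeff_hcomp; case: (_ =P a) => // _; rewrite eqxx.
Qed.

Lemma hcompM a b c p q :
  homog_diff q b c -> hcomp a c (p * q) = hcomp a b p * q.
Proof.
move=> hq; rewrite {1 2}[p]mpolyE mulr_suml !linear_sum /= mulr_suml.
apply: eq_bigr => m _; rewrite -scalerAl !linearZ /= -scalerAl; congr (_ *: _).
rewrite {1 2}[q]mpolyE !mulr_sumr linear_sum /= big_seq [RHS]big_seq.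
apply: eq_bigr => l /hq hl.
rewrite -!scalerAr linearZ /= -mpolyXD !hcompX mdegD -addnA hl.
by case: ifP => _; rewrite ?mpolyXD ?mul0r.
Qed.

Lemma homog_diffM a b c (p q : S) :
  homog_diff p a b -> homog_diff q b c -> homog_diff (p * q) a c.
Proof. by move=> /homog_diffP hp hq; apply/homog_diffP; rewrite (hcompM _ _ hq) hp. Qed.

Lemma homog_diff0 a b : homog_diff (0 : S) a b.
Proof. by move=> m; rewrite msupp0. Qed.

Lemma homog_diffN a b (p : S) : homog_diff p a b -> homog_diff (- p) a b.
Proof. by rewrite !homog_diffP => h; rewrite linearN /= h. Qed.

Lemma homog_diff_shift a b c (p : S) :
  homog_diff p a b -> homog_diff p (a + c) (b + c).
Proof. by move=> h m /h <-; rewrite addnA. Qed.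

(** A nonzero constant term forces degree 0. This is how units in differentials and comparison maps
    are turned into equalities of degrees. *)
Lemma homog_diff_deg a b (p : S) : homog_diff p a b -> p@_0 != 0 -> a = b.
Proof. by move=> h; rewrite -mcoeff_msupp => /h; rewrite mdeg0. Qed.

Lemma mcoeff0M (p q : S) : (p * q)@_0 = p@_0 * q@_0.
Proof. exact: (rmorphM (mcoeff 0%MM)). Qed.

Definition homog_mx r s (dr : 'I_r -> nat) (ds : 'I_s -> nat) (M : 'M[S]_(r, s)) :=
  forall a b, homog_diff (M a b) (dr a) (ds b).

Definition hcomp_mx r s (dr : 'I_r -> nat) (ds : 'I_s -> nat) (M : 'M[S]_(r, s)) :
  'M[S]_(r, s) := \matrix_(a, b) hcomp (dr a) (ds b) (M a b).

Lemma homog_hcomp_mx r s dr ds (M : 'M[S]_(r, s)) : homog_mx dr ds (hcomp_mx dr ds M).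
Proof. by move=> a b; rewrite mxE; apply: homog_hcomp. Qed.

Lemma hcomp_mx_id r s dr ds (M : 'M[S]_(r, s)) :
  homog_mx dr ds M -> hcomp_mx dr ds M = M.
Proof. by move=> h; apply/matrixP=> a b; rewrite mxE; apply/homog_diffP. Qed.

Lemma hcomp_mxM r s t (dr : 'I_r -> nat) (ds : 'I_s -> nat) (dt : 'I_t -> nat)
    (M : 'M[S]_(r, s)) (N : 'M[S]_(s, t)) :
  homog_mx ds dt N -> hcomp_mx dr dt (M *m N) = hcomp_mx dr ds M *m N.
Proof.
move=> h; apply/matrixP=> a b; rewrite !mxE linear_sum /=.
by apply: eq_bigr => j _; rewrite mxE (hcompM _ _ (h _ _)).
Qed.

Lemma homog_mxM r s t (dr : 'I_r -> nat) (ds : 'I_s -> nat) (dt : 'I_t -> nat)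
    (M : 'M[S]_(r, s)) (N : 'M[S]_(s, t)) :
  homog_mx dr ds M -> homog_mx ds dt N -> homog_mx dr dt (M *m N).
Proof.
move=> hM hN; have : homog_mx dr dt (hcomp_mx dr dt (M *m N)) by apply: homog_hcomp_mx.
by rewrite (hcomp_mxM _ _ hN) hcomp_mx_id.
Qed.

Lemma homog_mxN r s (dr : 'I_r -> nat) (ds : 'I_s -> nat) (M : 'M[S]_(r, s)) :
  homog_mx dr ds M -> homog_mx dr ds (- M).
Proof. by move=> h a b; rewrite mxE; apply: homog_diffN. Qed.

(** Multiplication by the homogeneous [D] commutes with taking components, so the homogeneous part
    of any lift is again a lift. *)
Lemma graded_lift r s t (dr : 'I_r -> nat) (ds : 'I_s -> nat) (dt : 'I_t -> nat)
    (M : 'M[S]_(r, t)) (D : 'M[S]_(s, t)) :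
  homog_mx dr dt M -> homog_mx ds dt D -> (exists N, M = N *m D) ->
  exists2 N, homog_mx dr ds N & M = N *m D.
Proof.
move=> hM hD [N eN]; exists (hcomp_mx dr ds N); first exact: homog_hcomp_mx.
by rewrite -(hcomp_mxM _ _ hD) -eN hcomp_mx_id.
Qed.

End HomogeneousComponents.

Section Rows.

Variable R : nzRingType.

Lemma rowwise_choice q s (P : 'I_q -> 'rV[R]_s -> Prop) :
  (forall a, exists w, P a w) -> exists N : 'M[R]_(q, s), forall a, P a (row a N).
Proof.
move=> /fin_all_exists [f hf]; exists (\matrix_a f a) => a.
by rewrite rowK.
Qed.

Lemma exact_lift r s t (d : 'M[R]_(r, s)) (d' : 'M[R]_(t, r)) :
  (forall v : 'rV_r, v *m d = 0 -> exists w, v = w *m d') ->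
  forall q (M : 'M[R]_(q, r)), M *m d = 0 -> exists N, M = N *m d'.
Proof.
move=> ex q M hM.
have [a|N hN] := @rowwise_choice q t (fun a w => row a M = w *m d').
  by apply: ex; rewrite -row_mul hM row0.
by exists N; apply/row_matrixP => a; rewrite row_mul.
Qed.

End Rows.

(** * Comparison of graded resolutions *)

Section Comparison.

Variables (k : fieldType) (n : nat).
Local Notation S := {mpoly k[n]}.

Record homog_ideal (I : S -> Prop) : Prop := HomogIdeal {
  ideal0 : I 0;
  idealD : forall p q, I p -> I q -> I (p + q);
  idealM : forall p q, I q -> I (p * q);
  ideal_hcomp : forall a b p, I p -> I (hcomp a b p)
}.

Lemma idealN (I : S -> Prop) p : homog_ideal I -> I p -> I (- p).
Proof. by move=> hI hp; rewrite -mulN1r; apply: idealM. Qed.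

Lemma idealB (I : S -> Prop) p q : homog_ideal I -> I p -> I q -> I (p - q).
Proof. by move=> hI hp hq; apply: idealD => //; apply: idealN. Qed.

Lemma ideal_mulmx (I : S -> Prop) r s t (M : 'M[S]_(r, s)) (N : 'M[S]_(s, t)) :
  homog_ideal I -> (forall a b, I (N a b)) -> forall a b, I ((M *m N) a b).
Proof.
move=> hI hN a b; rewrite mxE; apply: (big_ind I) => [|p q|j _].
- exact: ideal0.
- exact: idealD.
- exact: idealM.
Qed.

Lemma aug_valE (F : free_complex k n) q (M : 'M[S]_(q, frank F 0)) a :
  aug_val (row a M) = (M *m faug F) a 0.
Proof. by rewrite /aug_val -row_mul mxE. Qed.

Lemma aug_valD (F : free_complex k n) (v w : 'rV[S]_(frank F 0)) :
  aug_val (v + w) = aug_val v + aug_val w.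
Proof. by rewrite /aug_val mulmxDl mxE. Qed.

Lemma aug_valZ (F : free_complex k n) c (v : 'rV[S]_(frank F 0)) :
  aug_val (c *: v) = c * aug_val v.
Proof. by rewrite /aug_val -scalemxAl mxE. Qed.

Lemma aug_valN (F : free_complex k n) (v : 'rV[S]_(frank F 0)) :
  aug_val (- v) = - aug_val v.
Proof. by rewrite /aug_val mulNmx mxE. Qed.

(** With a unit-free row and a unit-free column, a basis element is a cycle and is involved in no
    boundary after tensoring with the residue field, so it survives in Tor. *)
Definition unit_free_col (F : free_complex k n) i (a : 'I_(frank F i)) : Prop :=
  forall b, (fdiff F i b a)@_0%MM = 0.

Definition unit_free_row (F : free_complex k n) i : 'I_(frank F i) -> Prop :=
  match i with
  | 0 => fun _ => True
  | j.+1 => fun a => forall b, (fdiff F j a b)@_0%MM = 0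
  end.

Variable I : S -> Prop.
Hypothesis hI : homog_ideal I.

Lemma resolves_dd (F : free_complex k n) i :
  resolves I F -> fdiff F i.+1 *m fdiff F i = 0.
Proof.
case=> _ _ ex; apply/row_matrixP => a; rewrite row0 row_mul.
by apply/ex; exists (delta_mx 0 a); rewrite rowE.
Qed.

Lemma resolves_aug (F : free_complex k n) q (w : 'rV[S]_(frank F 1)) :
  resolves I F -> q = aug_val (w *m fdiff F 0) -> I q.
Proof. by case=> _ ex _ ->; apply/ex; exists w. Qed.

Lemma resolves_lift (F : free_complex k n) i q (M : 'M[S]_(q, frank F i.+1)) :
  resolves I F -> M *m fdiff F i = 0 -> exists N, M = N *m fdiff F i.+1.
Proof. by case=> _ _ ex; apply: exact_lift => v /ex. Qed.

Lemma resolves_lift0 (F : free_complex k n) q (M : 'M[S]_(q, frank F 0)) :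
  resolves I F -> (forall a, I ((M *m faug F) a 0)) ->
  exists N, M = N *m fdiff F 0.
Proof.
case=> _ ex _ h.
have [a|N hN] := @rowwise_choice _ q _ (fun a w => row a M = w *m fdiff F 0).
  by apply/ex; rewrite aug_valE.
by exists N; apply/row_matrixP => a; rewrite row_mul.
Qed.

Lemma homog_faug (F : free_complex k n) :
  graded_complex F -> homog_mx (@fgdeg _ _ F 0) (fun _ => 0) (faug F).
Proof. by case=> _ h a b; rewrite ord1. Qed.

Lemma homog_fdiff (F : free_complex k n) i :
  graded_complex F -> homog_mx (@fgdeg _ _ F i.+1) (@fgdeg _ _ F i) (fdiff F i).
Proof. by case=> h _; apply: h. Qed.

(** The usual lifting of the identity of S/I, made degree preserving by [graded_lift]. Augmentations
    agree only modulo [I], because [faug] lists representatives in S. *)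
Lemma comparison_map (F G : free_complex k n) :
  graded_complex F -> graded_complex G -> resolves I F -> resolves I G ->
  exists f : forall i, 'M[S]_(frank F i, frank G i),
    [/\ forall i, homog_mx (@fgdeg _ _ F i) (@fgdeg _ _ G i) (f i),
        forall a, I ((faug F - f 0 *m faug G) a 0)
      & forall i, fdiff F i *m f i = f i.+1 *m fdiff G i].
Proof.
move=> gF gG rF rG.
have [a|N hN] := @rowwise_choice _ (frank F 0) (frank G 0)
    (fun a w => I (faug F a 0 - aug_val w)).
  by case: rG.
pose f0 := hcomp_mx (@fgdeg _ _ F 0) (@fgdeg _ _ G 0) N.
(* The error of the homogeneous part is the homogeneous part of the error, which stays in the
   homogeneous ideal [I]. *)
have hf0 a : I ((faug F - f0 *m faug G) a 0).
  have -> : faug F - f0 *m faug G =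
      hcomp_mx (@fgdeg _ _ F 0) (fun _ => 0) (faug F - N *m faug G).
    rewrite /f0 -(hcomp_mxM _ _ (homog_faug gG)).
    rewrite -{1}(hcomp_mx_id (homog_faug gF)).
    by apply/matrixP => i j; rewrite !mxE linearB.
  rewrite mxE; apply: ideal_hcomp => //.
  by have := hN a; rewrite aug_valE !mxE.
have hom0 : homog_mx (@fgdeg _ _ F 0) (@fgdeg _ _ G 0) f0 by apply: homog_hcomp_mx.
pose R i (x : 'M[S]_(frank F i, frank G i)) (y : 'M[S]_(frank F i.+1, frank G i.+1)) :=
  [/\ homog_mx (@fgdeg _ _ F i) (@fgdeg _ _ G i) x,
      homog_mx (@fgdeg _ _ F i.+1) (@fgdeg _ _ G i.+1) y
    & fdiff F i *m x = y *m fdiff G i].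
have [||f [f0E hf]] := @dependent_choice2 _ R f0.
- have [N1 eN1] : exists N, fdiff F 0 *m f0 = N *m fdiff G 0.
    apply: resolves_lift0 => // a.
    have -> : (fdiff F 0 *m f0) *m faug G =
        fdiff F 0 *m faug F - fdiff F 0 *m (faug F - f0 *m faug G).
      by rewrite mulmxBr opprB addrC subrK mulmxA.
    rewrite mxE [X in _ + X]mxE; apply: idealB => //.
      rewrite -aug_valE; apply: (resolves_aug (w := delta_mx 0 a) rF).
      by rewrite -rowE.
    by apply: ideal_mulmx => // i j; rewrite ord1.
  have [| |N2 hN2 eN2] := @graded_lift _ _ _ _ _ (@fgdeg _ _ F 1) (@fgdeg _ _ G 1)
     (@fgdeg _ _ G 0) (fdiff F 0 *m f0) (fdiff G 0) _ _ (ex_intro _ N1 eN1).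
  + exact: (homog_mxM (homog_fdiff gF) hom0).
  + exact: homog_fdiff.
  by exists N2.
- move=> i x y [hx hy exy].
  have [N1 eN1] : exists N, fdiff F i.+1 *m y = N *m fdiff G i.+1.
    by apply: resolves_lift => //; rewrite -mulmxA -exy mulmxA resolves_dd // mul0mx.
  have [| |N2 hN2 eN2] := @graded_lift _ _ _ _ _ (@fgdeg _ _ F i.+2)
     (@fgdeg _ _ G i.+2) (@fgdeg _ _ G i.+1) (fdiff F i.+1 *m y) (fdiff G i.+1) _ _
     (ex_intro _ N1 eN1).
  + exact: (homog_mxM (homog_fdiff gF) hy).
  + exact: homog_fdiff.
  by exists N2.
exists f; split=> [i|a|i]; [by case: (hf i) | by rewrite f0E | by case: (hf i)].
Qed.

(** A chain endomorphism inducing zero on S/I is null-homotopic: what remains of it after the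
    previous homotopy step is a cycle, hence lifts. *)
Lemma null_homotopy (F : free_complex k n) (e : forall i, 'M[S]_(frank F i)) :
  resolves I F ->
  (forall a, I ((e 0 *m faug F) a 0)) ->
  (forall i, fdiff F i *m e i = e i.+1 *m fdiff F i) ->
  exists h : forall i, 'M[S]_(frank F i, frank F i.+1),
    e 0 = h 0 *m fdiff F 0 /\
    forall i, e i.+1 = fdiff F i *m h i + h i.+1 *m fdiff F i.+1.
Proof.
move=> rF e0 ce.
have [h0 eh0] : exists N, e 0 = N *m fdiff F 0 by apply: resolves_lift0.
have lift i (x : 'M[S]_(frank F i, frank F i.+1)) :
    fdiff F i *m e i = fdiff F i *m x *m fdiff F i ->
    exists y, e i.+1 = fdiff F i *m x + y *m fdiff F i.+1.
  move=> ex; have [|y ey] := @resolves_lift F i _ (e i.+1 - fdiff F i *m x) rF.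
    by rewrite mulmxBl -ce ex subrr.
  by exists y; rewrite -ey addrC subrK.
pose R i (x : 'M[S]_(frank F i, frank F i.+1)) (y : 'M[S]_(frank F i.+1, frank F i.+2)) :=
  e i.+1 = fdiff F i *m x + y *m fdiff F i.+1.
have [||h [h0E hh]] := @dependent_choice2 _ R h0.
- by apply: lift; rewrite eh0 mulmxA.
- move=> i x y exy; apply: lift.
  by rewrite exy mulmxDr !mulmxA resolves_dd // mul0mx add0r.
by exists h; split=> //; rewrite h0E.
Qed.

(* Comparison maps F -> G -> F compose to 1 plus a null-homotopic map, whose
   (a, a) entry lies in the maximal ideal; so some entry of F -> G in row a is
   a unit, and such an entry forces equality of degrees. *)
Lemma minimal_generator_degree (F G : free_complex k n) i (a : 'I_(frank F i)) :
  graded_complex F -> graded_complex G -> resolves I F -> resolves I G ->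
  unit_free_row a -> unit_free_col a ->
  exists b : 'I_(frank G i), fgdeg b = fgdeg a.
Proof.
move=> gF gG rF rG ra ca.
have [f [hf f0 cf]] := comparison_map gF gG rF rG.
have [g [_ g0 cg]] := comparison_map gG gF rG rF.
pose e i : 'M[S]_(frank F i) := f i *m g i - 1%:M.
have [||h [h0 hS]] := @null_homotopy F e rF.
- move=> b.
  have -> : e 0 *m faug F = - (faug F - f 0 *m faug G)
      - f 0 *m (faug G - g 0 *m faug F).
    by rewrite /e mulmxBl mul1mx mulmxBr mulmxA !opprB [RHS]addrC subrKA.
  rewrite mxE [X in X + _]mxE [X in _ + X]mxE; apply: idealB => //.
    exact: idealN.
  by apply: ideal_mulmx => // c d; rewrite ord1.
- move=> j; rewrite /e mulmxBr mulmxBl mulmxA cf mulmx1 mul1mx.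
  by rewrite -[f j.+1 *m fdiff G j *m g j]mulmxA cg mulmxA.
have eaa : (e i a a)@_0%MM = 0.
  case: i a ra ca => [|i] a ra ca.
    rewrite h0 mxE raddf_sum big1 //= => b _.
    by rewrite mcoeff0M ca mulr0.
  rewrite hS mxE [X in X + _]mxE [X in _ + X]mxE raddfD /= !raddf_sum /=.
  by rewrite !big1 ?addr0 // => b _; rewrite mcoeff0M ?ca ?ra ?mulr0 ?mul0r.
have fg : (((f i *m g i) a a)@_0%MM != 0).
  have -> : f i *m g i = e i + 1%:M by rewrite subrK.
  by rewrite mxE raddfD /= eaa add0r mxE eqxx mcoeff1 eqxx oner_neq0.
have [b hb] : exists b, (f i a b)@_0%MM != 0.
  apply/existsP; apply: contraR fg => /existsPn h'.
  rewrite mxE raddf_sum big1 //= => b _; rewrite mcoeff0M.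
  by move: (h' b); rewrite negbK => /eqP ->; rewrite mul0r.
by exists b; rewrite (homog_diff_deg (hf i a b) hb).
Qed.

End Comparison.

(** * Mapping cone and horseshoe *)

Section Blocks.

Variable R : nzRingType.

(** An extension of exact complexes is exact: lift the quotient part first, then correct the sub
    part. The condition on [t] and [t'] says that the off-diagonal block of the composite
    vanishes. *)
Lemma block_exact a0 a1 a2 c0 c1 c2 (dA : 'M[R]_(a1, a0)) (dA' : 'M[R]_(a2, a1))
    (dC : 'M[R]_(c1, c0)) (dC' : 'M[R]_(c2, c1)) (t : 'M[R]_(c1, a0))
    (t' : 'M[R]_(c2, a1)) :
  (forall v : 'rV_a1, v *m dA = 0 <-> exists w, v = w *m dA') ->
  (forall v : 'rV_c1, v *m dC = 0 <-> exists w, v = w *m dC') ->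
  dC' *m t + t' *m dA = 0 ->
  forall v : 'rV_(a1 + c1), v *m block_mx dA 0 t dC = 0 <->
    exists w, v = w *m block_mx dA' 0 t' dC'.
Proof.
move=> exA exC ht v; rewrite -[v]hsubmxK; set va := lsubmx v; set vc := rsubmx v.
rewrite mul_row_block mulmx0 add0r; split=> [|[w]].
  rewrite -[X in _ = X]row_mx0 => /eq_row_mx [hA /exC [wc ewc]].
  have /exA [wa ewa] : (va - wc *m t') *m dA = 0.
    by rewrite mulmxBl -mulmxA -[t' *m dA](addKr (dC' *m t)) ht addr0 mulmxN opprK
      mulmxA -ewc.
  exists (row_mx wa wc); rewrite mul_row_block mulmx0 add0r -ewa -ewc.
  by rewrite subrK.
rewrite -[w]hsubmxK mul_row_block mulmx0 add0r => /eq_row_mx [-> ->].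
set wa := lsubmx w; set wc := rsubmx w.
have -> : wc *m dC' *m dC = 0 by apply/exC; exists wc.
have h : wa *m dA' *m dA = 0 by apply/exA; exists wa.
by rewrite mulmxDl h add0r -!mulmxA -mulmxDr addrC ht mulmx0 row_mx0.
Qed.

End Blocks.

Section Constructions.

Variables (k : fieldType) (n : nat).
Local Notation S := {mpoly k[n]}.
Implicit Types (F A C : free_complex k n) (I J : S -> Prop).

Definition colon I x : S -> Prop := fun p => I (p * x).
Definition adjoin I x : S -> Prop := fun p => exists q, I (p - q * x).

Definition sum_deg a b (dl : 'I_a -> nat) (dr : 'I_b -> nat) (i : 'I_(a + b)) :=
  match split i with inl j => dl j | inr j => dr j end.

Lemma sum_degl a b dl dr (i : 'I_a) : sum_deg dl dr (lshift b i) = dl i.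
Proof. by rewrite /sum_deg (unsplitK (inl i)). Qed.

Lemma sum_degr a b dl dr (i : 'I_b) : sum_deg dl dr (rshift a i) = dr i.
Proof. by rewrite /sum_deg (unsplitK (inr i)). Qed.

Lemma homog_block_mx a b c d da db dc dd (M : 'M[S]_(a, c)) (N : 'M[S]_(a, d))
    (P : 'M[S]_(b, c)) (Q : 'M[S]_(b, d)) :
  homog_mx da dc M -> homog_mx da dd N -> homog_mx db dc P -> homog_mx db dd Q ->
  homog_mx (sum_deg da db) (sum_deg dc dd) (block_mx M N P Q).
Proof.
move=> hM hN hP hQ i j.
case: (split_ordP i) => {}i ->; case: (split_ordP j) => {}j ->;
  by rewrite ?sum_degl ?sum_degr ?block_mxEul ?block_mxEur ?block_mxEdl ?block_mxEdr.
Qed.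

Lemma homog_col_mx a b c da db dc (M : 'M[S]_(a, c)) (P : 'M[S]_(b, c)) :
  homog_mx da dc M -> homog_mx db dc P ->
  homog_mx (sum_deg da db) dc (col_mx M P).
Proof.
move=> hM hP i j.
by case: (split_ordP i) => {}i ->; rewrite ?sum_degl ?sum_degr ?col_mxEu ?col_mxEd.
Qed.

Lemma homog_mx_shift a b da db (M : 'M[S]_(a, b)) :
  homog_mx da db M -> homog_mx (fun i => (da i).+1) (fun i => (db i).+1) M.
Proof. by move=> h i j; rewrite -[(da i).+1]addn1 -[(db j).+1]addn1; apply: homog_diff_shift. Qed.

Lemma homog_mx0 a b da db : homog_mx da db (0 : 'M[S]_(a, b)).
Proof. by move=> i j; rewrite mxE; apply: homog_diff0. Qed.

Lemma homog_linear_scalar x a da : homog_diff x 1 0 ->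
  homog_mx (fun i => (da i).+1) da (x%:M : 'M[S]_a).
Proof.
move=> hx i j; rewrite mxE; case: eqP => [->|_]; last exact: homog_diff0.
by have := @homog_diff_shift _ _ _ _ (da j) _ hx; rewrite add1n add0n.
Qed.

Lemma homog_mulr_linear x a da (M : 'cV[S]_a) : homog_diff x 1 0 ->
  homog_mx da (fun _ => 0) M ->
  homog_mx (fun i => (da i).+1) (fun _ => 0) (map_mx (fun p => p * x) M).
Proof.
move=> hx hM i j; rewrite mxE; apply: homog_diffM hx.
by rewrite -[(da i).+1]addn1 -[X in homog_diff _ _ X]add0n; apply: homog_diff_shift.
Qed.

(** The degrees of [A] go up by one and its augmentation is multiplied by [x], because [A] resolves
    the image of S/(I : x)(-1) under multiplication by [x]. *)
Definition horseshoe A C (x : S) (t : forall i, 'M[S]_(frank C i.+1, frank A i)) :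
    free_complex k n :=
  {| frank := fun i => (frank A i + frank C i)%N;
     fgdeg := fun i => sum_deg (fun a => (@fgdeg _ _ A i a).+1) (@fgdeg _ _ C i);
     fdiff := fun i => block_mx (fdiff A i) 0 (t i) (fdiff C i);
     faug := col_mx (map_mx (fun p => p * x) (faug A)) (faug C) |}.

Lemma mulmx_map_mulr q a x (M : 'M[S]_(q, a)) (N : 'cV[S]_a) :
  M *m map_mx (fun p => p * x) N = map_mx (fun p => p * x) (M *m N).
Proof.
apply/matrixP => i j; rewrite !mxE mulr_suml; apply: eq_bigr => l _.
by rewrite !mxE mulrA.
Qed.

Lemma aug_horseshoe A C x t (va : 'rV[S]_(frank A 0)) (vc : 'rV[S]_(frank C 0)) :
  @aug_val _ _ (horseshoe x t) (row_mx va vc) = aug_val va * x + aug_val vc.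
Proof. by rewrite /aug_val /= mul_row_col mulmx_map_mulr mxE [X in X + _]mxE. Qed.

(** Horseshoe lemma for 0 -> S/(I : x)(-1) -> S/I -> S/(I, x) -> 0. The connecting maps anticommute
    with the differentials and are found by successive graded lifts along [A]. *)
Lemma horseshoe_resolution I A C x :
  homog_ideal I -> homog_diff x 1 0 -> graded_complex A -> graded_complex C ->
  resolves (colon I x) A -> resolves (adjoin I x) C ->
  exists t, graded_complex (@horseshoe A C x t) /\ resolves I (@horseshoe A C x t).
Proof.
move=> hI hx gA gC rA rC.
pose Ax : 'cV[S]_(frank A 0) := map_mx (fun p => p * x) (faug A).
have hAx : homog_mx (fun a => (@fgdeg _ _ A 0 a).+1) (fun _ => 0) Ax.
  exact: homog_mulr_linear (homog_faug gA).
pose dA1 i (a : 'I_(frank A i)) := (fgdeg a).+1.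
have [c|t0' ht0'] := @rowwise_choice _ (frank C 1) (frank A 0)
    (fun c w => I ((w *m Ax) 0 0 + (fdiff C 0 *m faug C) c 0)).
  have [q hq] : adjoin I x ((fdiff C 0 *m faug C) c 0).
    rewrite -aug_valE; apply: (resolves_aug (w := delta_mx 0 c) rC).
    by rewrite -rowE.
  have [w hw] : exists w, colon I x (q - @aug_val _ _ A w) by case: rA.
  (* The image of row [c] lies in (I, x) with coefficient [q] of [x]; subtracting a lift of [q] to
     the augmentation of [A] brings it into [I]. *)
  exists (- w); rewrite mulNmx mulmx_map_mulr [X in X + _]mxE [X in - X]mxE.
  have -> : - ((w *m faug A) 0 0 * x) + (fdiff C 0 *m faug C) c 0 =
     ((fdiff C 0 *m faug C) c 0 - q * x) + (q - aug_val w) * x.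
    by rewrite /aug_val mulrBl addrA subrK addrC.
  exact: idealD.
pose t0 := hcomp_mx (@fgdeg _ _ C 1) (@dA1 0) t0'.
have ht0 c : I ((t0 *m Ax + fdiff C 0 *m faug C) c 0).
  have -> : t0 *m Ax + fdiff C 0 *m faug C =
      hcomp_mx (@fgdeg _ _ C 1) (fun _ => 0) (t0' *m Ax + fdiff C 0 *m faug C).
    rewrite /t0 -(hcomp_mxM _ _ hAx).
    rewrite -{1}(hcomp_mx_id (homog_mxM (homog_fdiff gC) (homog_faug gC))).
    by apply/matrixP => i j; rewrite !mxE linearD.
  rewrite mxE; apply: ideal_hcomp => //.
  by have := ht0' c; rewrite -row_mul !mxE.
have ht00 : homog_mx (@fgdeg _ _ C 1) (@dA1 0) t0 by apply: homog_hcomp_mx.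
pose R i (y : 'M[S]_(frank C i.+1, frank A i)) (z : 'M[S]_(frank C i.+2, frank A i.+1)) :=
  [/\ homog_mx (@fgdeg _ _ C i.+1) (@dA1 i) y,
      homog_mx (@fgdeg _ _ C i.+2) (@dA1 i.+1) z
    & fdiff C i.+1 *m y + z *m fdiff A i = 0].
have step i (y : 'M[S]_(frank C i.+1, frank A i)) :
    homog_mx (@fgdeg _ _ C i.+1) (@dA1 i) y ->
    (exists z, fdiff C i.+1 *m y = z *m fdiff A i) -> exists z, R i y z.
  move=> hy hz.
  have [| |z hz' ez] := @graded_lift _ _ _ _ _ (@fgdeg _ _ C i.+2) (@dA1 i.+1)
      (@dA1 i) _ _ _ _ hz.
  - exact: homog_mxM (homog_fdiff gC) hy.
  - exact: homog_mx_shift (homog_fdiff gA).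
  exists (- z); split=> //; first exact: homog_mxN.
  by rewrite ez mulNmx subrr.
have [||t [t0E tR]] := @dependent_choice2 _ R t0.
- apply: step => //; apply: (resolves_lift0 rA) => c; rewrite /colon.
  have -> : (fdiff C 1 *m t0 *m faug A) c 0 * x =
      (fdiff C 1 *m (t0 *m Ax + fdiff C 0 *m faug C)) c 0.
    rewrite mulmxDr [fdiff C 1 *m (fdiff C 0 *m _)]mulmxA (resolves_dd _ rC).
    by rewrite mul0mx addr0 mulmxA mulmx_map_mulr [RHS]mxE.
  by apply: ideal_mulmx => // a b; rewrite ord1.
- move=> i y z [hy hz eyz]; apply: step => //; apply: (resolves_lift rA).
  have -> : fdiff C i.+2 *m z *m fdiff A i =
     fdiff C i.+2 *m (fdiff C i.+1 *m y + z *m fdiff A i).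
    by rewrite mulmxDr !mulmxA (resolves_dd _ rC) mul0mx add0r.
  by rewrite eyz mulmx0.
have t0A c : I ((t 0 *m Ax + fdiff C 0 *m faug C) c 0) by rewrite t0E.
exists t; split.
  split=> [i|a]; last exact: (homog_col_mx hAx (homog_faug gC)).
  have [ht _ _] := tR i; apply: homog_block_mx ht _.
  - exact: homog_mx_shift (homog_fdiff gA).
  - exact: homog_mx0.
  - exact: homog_fdiff.
have tI (w : 'rV[S]_(frank C 1)) :
    I (aug_val (w *m t 0) * x + aug_val (w *m fdiff C 0)).
  have -> : aug_val (w *m t 0) * x + aug_val (w *m fdiff C 0) =
      (w *m (t 0 *m Ax + fdiff C 0 *m faug C)) 0 0.
    rewrite /aug_val mulmxDr !mulmxA mulmx_map_mulr [RHS]mxE.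
    by rewrite [X in _ = X + _]mxE.
  by apply: ideal_mulmx => // a b; rewrite ord1.
have alg (a b c : S) : (a - b) * x = a * x + c - (b * x + c).
  by rewrite opprD addrACA subrr addr0 mulrBl.
have [surA exA0 exA] := rA; have [surC exC0 exC] := rC.
split.
- move=> p; have [vc [q hq]] := surC p; have [va hva] := surA q.
  exists (row_mx va vc); rewrite aug_horseshoe.
  have -> : p - (aug_val va * x + aug_val vc) =
      (p - aug_val vc - q * x) + (q - aug_val va) * x.
    by rewrite mulrBl addrA subrK opprD addrA addrAC.
  exact: idealD.
- move=> v; rewrite /= in v *; rewrite -[v]hsubmxK.
  set va := lsubmx v; set vc := rsubmx v.
  rewrite aug_horseshoe /=; split=> [hv|[w]].
    have [wc ewc] : exists w, vc = w *m fdiff C 0.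
      apply/exC0; exists (- aug_val va).
      by rewrite mulNr opprK addrC.
    have [wa ewa] : exists w, va - wc *m t 0 = w *m fdiff A 0.
      apply/exA0; rewrite /colon aug_valD aug_valN (alg _ _ (aug_val vc)).
      by have := idealB hI hv (tI wc); rewrite -ewc.
    exists (row_mx wa wc).
    by rewrite mul_row_block mulmx0 add0r -ewa -ewc subrK.
  rewrite -[w]hsubmxK mul_row_block mulmx0 add0r => /eq_row_mx [-> ->].
  rewrite aug_valD mulrDl -addrA; apply: idealD => //.
  by apply/exA0; exists (lsubmx w).
- move=> i; apply: block_exact => //.
  by have [_ _] := tR i.
Qed.

(** This definition and the next three form the mapping cone of multiplication by [x] from F(-1) to
    F. Position 0 has no shifted summand and is treated separately. *)
Definition cone_rank F i :=
  match i with 0 => frank F 0 | j.+1 => (frank F j.+1 + frank F j)%N end.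

Definition cone_deg F i : 'I_(cone_rank F i) -> nat :=
  match i with
  | 0 => @fgdeg _ _ F 0
  | j.+1 => sum_deg (@fgdeg _ _ F j.+1) (fun a => (@fgdeg _ _ F j a).+1)
  end.

Definition cone_diff F (x : S) i : 'M[S]_(cone_rank F i.+1, cone_rank F i) :=
  match i with
  | 0 => col_mx (fdiff F 0) x%:M
  | j.+1 => block_mx (fdiff F j.+1) 0 x%:M (- fdiff F j)
  end.

Definition linear_cone F (x : S) : free_complex k n :=
  {| frank := cone_rank F; fgdeg := @cone_deg F; fdiff := cone_diff F x;
     faug := faug F : 'cV[S]_(cone_rank F 0) |}.

Lemma linear_cone_resolution I F x :
  homog_ideal I -> homog_diff x 1 0 -> (forall p, I (p * x) -> I p) ->
  graded_complex F -> resolves I F ->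
  graded_complex (linear_cone F x) /\ resolves (adjoin I x) (linear_cone F x).
Proof.
move=> hI hx reg gF rF; split.
  split=> [[|i]|a]; last exact: (homog_faug gF).
  - exact: homog_col_mx (homog_fdiff gF) (homog_linear_scalar _ hx).
  - apply: homog_block_mx.
    + exact: homog_fdiff.
    + exact: homog_mx0.
    + exact: homog_linear_scalar.
    + exact/homog_mx_shift/homog_mxN/homog_fdiff.
have [surF exF0 exF] := rF.
have augd (w : 'rV[S]_(frank F 1)) : I (aug_val (w *m fdiff F 0)).
  by apply/exF0; exists w.
split.
- by move=> p; have [v hv] := surF p; exists v; exists 0; rewrite mul0r subr0.
- move=> v; change ('rV[S]_(frank F 0)) in v.
  change (adjoin I x (@aug_val _ _ F v) <->
    exists w : 'rV_(frank F 1 + frank F 0), v = w *m col_mx (fdiff F 0) x%:M).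
  split=> [[q hq]|[w]].
    have [t ht] := surF q.
    have [u eu] : exists w, v - x *: t = w *m fdiff F 0.
      apply/exF0; rewrite aug_valD aug_valN aug_valZ.
      have -> : aug_val v - x * aug_val t =
         (aug_val v - q * x) + (q - aug_val t) * x.
        by rewrite mulrBl addrA subrK mulrC.
      by apply: idealD => //; rewrite mulrC; apply: idealM.
    by exists (row_mx u t); rewrite mul_row_col mul_mx_scalar -eu subrK.
  rewrite -[w]hsubmxK mul_row_col mul_mx_scalar => ->.
  by exists (aug_val (rsubmx w)); rewrite aug_valD aug_valZ mulrC addrK.
- case=> [v|i]; last first.
    apply: block_exact => //.
      move=> v; rewrite -[0]oppr0 mulmxN; split=> [/oppr_inj /exF [w ->]|[w ->]].
        by exists (- w); rewrite mulmxN mulNmx opprK.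
      congr (- _); apply/exF; exists (- w).
      by rewrite mulmxN mulNmx.
    by rewrite mulNmx mul_mx_scalar mul_scalar_mx addNr.
  change ('rV[S]_(frank F 1 + frank F 0)) in v.
  change (v *m col_mx (fdiff F 0) x%:M = 0 <-> exists w : 'rV_(frank F 2 + frank F 1),
    v = w *m block_mx (fdiff F 1) 0 x%:M (- fdiff F 0)).
  rewrite -[v]hsubmxK; set u := lsubmx v; set t := rsubmx v.
  rewrite mul_row_col mul_mx_scalar; split=> [e|[w]].
    (* Regularity of [x] modulo [I] enters here: [u] and [t] satisfy u d + x t = 0, so x times the
       augmentation of [t] lies in [I]. Higher positions follow from exactness of [F] alone. *)
    have /exF0 [s es] : I (aug_val t).
      apply: reg; rewrite mulrC -aug_valZ -[x *: t](addKr (u *m fdiff F 0)) e addr0.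
      by rewrite aug_valN; apply: idealN.
    have /exF [r er] : (u + x *: s) *m fdiff F 0 = 0.
      by rewrite mulmxDl -scalemxAl -es.
    exists (row_mx r (- s)); rewrite mul_row_block mulmx0 add0r.
    by rewrite mul_mx_scalar mulmxN mulNmx opprK -es -er scalerN addrK.
  rewrite -[w]hsubmxK mul_row_block mulmx0 add0r => /eq_row_mx [-> ->].
  rewrite mulmxDl -mulmxA (resolves_dd _ rF) mulmx0 add0r mul_mx_scalar.
  by rewrite -scalemxAl mulmxN scalerN subrr.
Qed.

(** * Extremal generators and their survival under the two constructions *)

Definition deg_bound F r := forall i (a : 'I_(frank F i)), (fgdeg a <= i + r)%N.

(* A resolution of length p whose degrees are at most i + r in position i and
   which attains degree p + r in position p with a generator surviving in Tor_p. *)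
Definition corner I p r := exists F : free_complex k n,
  [/\ graded_complex F, resolves I F, deg_bound F r,
      forall i, (p < i)%N -> frank F i = 0
    & exists a : 'I_(frank F p), fgdeg a = (p + r)%N /\ unit_free_row a].

(** Weaker than [corner]: the surviving generator may sit below the top position, so its column must
    be tested too. *)
Definition attains I r := exists F : free_complex k n,
  [/\ graded_complex F, resolves I F, deg_bound F r
    & exists p (a : 'I_(frank F p)),
        [/\ fgdeg a = (p + r)%N, unit_free_row a & unit_free_col a]].

Lemma ord_of_0 (T : Prop) m : m = 0 -> 'I_m -> T.
Proof. by move=> -> []. Qed.

(** Nothing lies above position [p], so the column condition is vacuous. *)
Lemma corner_attains I p r : corner I p r -> attains I r.
Proof.
case=> F [gF rF bF z [a [da ra]]]; exists F; split=> //; exists p, a; split=> //.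
by move=> b; apply: (ord_of_0 _ (z p.+1 (ltnSn p)) b).
Qed.

Lemma mcoeff0_linear (x : S) : homog_diff x 1 0 -> x@_0 = 0.
Proof. by move=> h; apply/eqP; apply/negPn/negP => /(homog_diff_deg h). Qed.

(** The shifted copy of the corner generator moves one position up; its row consists of [x] and the
    negated old row, neither containing a unit. *)
Lemma corner_adjoin_regular I x p r :
  homog_ideal I -> homog_diff x 1 0 -> (forall q, I (q * x) -> I q) ->
  corner I p r -> corner (adjoin I x) p.+1 r.
Proof.
move=> hI hx reg [F [gF rF bF z [a [da ra]]]].
have [gK rK] := linear_cone_resolution hI hx reg gF rF.
exists (linear_cone F x); split=> //.
- case=> [|i] b /=; first exact: bF.
  case: (split_ordP b) => {}b ->; rewrite ?sum_degl ?sum_degr; first exact: bF.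
  by rewrite addSn ltnS; apply: bF.
- by case=> // i hi /=; rewrite !z // ltnW.
exists (rshift _ a); split; first by rewrite /= sum_degr da addSn.
case: p a da ra {z} => [|p] a da ra b /=.
  rewrite col_mxEd mxE; case: eqP => _; last by rewrite mcoeff0.
  exact: mcoeff0_linear.
case: (split_ordP b) => {}b ->; rewrite ?block_mxEdl ?block_mxEdr mxE.
  by case: eqP => _; rewrite ?mcoeff0 // mcoeff0_linear.
by rewrite mcoeffN ra oppr0.
Qed.

(** In the horseshoe the row of a generator of [A] is its old row padded with zeros, and p' <= p
    keeps position [p] the last one. *)
Lemma corner_of_colon I x p p' r r' :
  homog_ideal I -> homog_diff x 1 0 -> (p' <= p)%N -> (r' <= r.+1)%N ->
  corner (colon I x) p r -> corner (adjoin I x) p' r' -> corner I p r.+1.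
Proof.
move=> hI hx hp hr [A [gA rA bA zA [a [da ra]]]] [C [gC rC bC zC _]].
have [t [gH rH]] := horseshoe_resolution hI hx gA gC rA rC.
exists (horseshoe x t); split=> //.
- move=> i b; case: (split_ordP b) => {}b ->; rewrite /= ?sum_degl ?sum_degr.
    by rewrite addnS ltnS; apply: bA.
  by apply: leq_trans (bC _ _) _; rewrite leq_add2l.
- by move=> i hi /=; rewrite zA ?zC // (leq_ltn_trans hp).
exists (lshift _ a); split; first by rewrite /= sum_degl da addnS.
case: p a da ra {hp zA} => [|p] a da ra //= b.
case: (split_ordP b) => {}b ->; rewrite ?block_mxEul ?block_mxEur; first exact: ra.
by rewrite mxE mcoeff0.
Qed.

(** The corner of [C] is kept. Its column meets only the zero block and the rows of [C] in position
    p' + 1, of which there are none; its row is controlled by degrees, using r < r'. *)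
Lemma attains_of_adjoin I x p' r r' s :
  homog_ideal I -> homog_diff x 1 0 -> (r < r')%N ->
  corner (colon I x) s r -> corner (adjoin I x) p' r' -> attains I r'.
Proof.
move=> hI hx hr [A [gA rA bA _ _]] [C [gC rC bC zC [c [dc rc]]]].
have [t [gH rH]] := horseshoe_resolution hI hx gA gC rA rC.
exists (horseshoe x t); split=> //.
  move=> i b; case: (split_ordP b) => {}b ->; rewrite /= ?sum_degl ?sum_degr //.
  apply: leq_ltn_trans (bA _ _) _; by rewrite ltn_add2l.
exists p', (rshift _ c); split; first by rewrite /= sum_degr dc.
  case: p' c dc rc {zC} => [|p] c dc rc //= b.
  case: (split_ordP b) => {}b ->; rewrite ?block_mxEdl ?block_mxEdr //.
  (* The generator c has larger degree than its target in the colon part, so no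
     entry of the connecting map in its row can be a unit. *)
  apply/eqP/negPn/negP => nz.
  have := homog_diff_deg (gH.1 p (rshift _ c) (lshift _ b)) _.
  rewrite /= block_mxEdl => /(_ nz); rewrite sum_degr sum_degl dc.
  have := bA p b; lia.
move=> b; case: (split_ordP b) => {}b -> /=; rewrite ?block_mxEur ?block_mxEdr.
  by rewrite mxE mcoeff0.
by apply: (ord_of_0 _ (zC p'.+1 (ltnSn p')) b).
Qed.

End Constructions.

(** * Existence of minimal resolutions, and regularity *)

Section FinitePresentation.

Variable R : comNzRingType.

Definition rowspan r m (A : 'M[R]_(r, m)) : 'rV[R]_m -> Prop :=
  fun v => exists w, v = w *m A.

Definition lkernel r m (A : 'M[R]_(r, m)) : 'rV[R]_r -> Prop := fun v => v *m A = 0.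

(* K has a free resolution whose first L terms are finitely generated. *)
Fixpoint fin_pres L m (K : 'rV[R]_m -> Prop) : Prop :=
  match L with
  | 0 => True
  | L'.+1 => exists r (A : 'M[R]_(r, m)),
      (forall v, K v <-> rowspan A v) /\ fin_pres L' (lkernel A)
  end.

Lemma fin_pres_ext L m (K K' : 'rV[R]_m -> Prop) :
  (forall v, K v <-> K' v) -> fin_pres L K -> fin_pres L K'.
Proof.
case: L => //= L e [r [A [hA fA]]]; exists r, A; split=> // v.
by rewrite -e.
Qed.

(** [M] is injective on [K], so generators of [K] and all their relations are carried over
    unchanged. *)
Lemma fin_pres_embed L m m' (K : 'rV[R]_m -> Prop) (M : 'M[R]_(m, m')) :
  (forall v, K v -> v *m M = 0 -> v = 0) -> fin_pres L K ->
  fin_pres L (fun u => exists v, K v /\ u = v *m M).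
Proof.
case: L => //= L inj [r [A [hA fA]]]; exists r, (A *m M); split.
  move=> u; split=> [[v [/hA [w ->] ->]]|[w ->]]; first by exists w; rewrite mulmxA.
  by exists (w *m A); split; [apply/hA; exists w | rewrite mulmxA].
apply: fin_pres_ext fA => v; rewrite /lkernel mulmxA; split=> [->|h].
  by rewrite mul0mx.
by apply: inj => //; apply/hA; exists v.
Qed.

Lemma fin_pres_sum L m s (K : 'rV[R]_m -> Prop) :
  fin_pres L K -> fin_pres L (fun v : 'rV[R]_(m + s) => K (lsubmx v)).
Proof.
case: L => //= L [r [A [hA fA]]]; exists (r + s)%N, (block_mx A 0 0 1%:M); split.
  move=> v; split=> [/hA [w ew]|[w ->]].
    exists (row_mx w (rsubmx v)).
    by rewrite mul_row_block !mulmx0 addr0 add0r mulmx1 -ew hsubmxK.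
  apply/hA; exists (lsubmx w).
  by rewrite -[w in LHS]hsubmxK mul_row_block row_mxKl mulmx0 addr0.
apply: fin_pres_ext (fin_pres_embed (M := row_mx 1%:M 0 : 'M_(r, r + s)) _ fA).
  move=> v; rewrite /lkernel; split=> [[w [hw ->]]|].
    by rewrite mul_mx_row mulmx1 mulmx0 mul_row_block hw !mul0mx !mulmx0 !addr0 row_mx0.
  rewrite -[v]hsubmxK mul_row_block !mulmx0 addr0 add0r mulmx1.
  rewrite -[X in _ = X]row_mx0 => /eq_row_mx [h1 h2].
  by exists (lsubmx v); split=> //; rewrite mul_mx_row mulmx1 mulmx0 h2.
by move=> v _; rewrite mul_mx_row mulmx1 mulmx0 -[X in _ = X]row_mx0 => /eq_row_mx [].
Qed.

(* Schanuel: P and Q induce mutually inverse maps between R^m'/K' and R^m/K. *)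
Lemma fin_pres_iso L m m' (K : 'rV[R]_m -> Prop) (K' : 'rV[R]_m' -> Prop)
    (P : 'M[R]_(m', m)) (Q : 'M[R]_(m, m')) :
  (forall v w, K' v -> K' w -> K' (v + w)) ->
  (forall v, K' v -> K (v *m P)) -> (forall v, K v -> K' (v *m Q)) ->
  (forall v, K' (v - v *m P *m Q)) -> (forall v, K (v *m Q *m P - v)) ->
  fin_pres L K -> fin_pres L K'.
Proof.
case: L => //= L K'D hP hQ hPQ hQP [s [B [hB fB]]].
have [a|N hN] := @rowwise_choice _ m s (fun a w => row a (Q *m P - 1%:M) = w *m B).
  apply/hB; rewrite rowE mulmxBr mulmx1 mulmxA; exact: hQP.
have NB : N *m B = Q *m P - 1%:M by apply/row_matrixP => a; rewrite row_mul.
exists (s + m')%N, (col_mx (B *m Q) (1%:M - P *m Q)); split.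
  move=> v; split=> [hv|[w ->]].
    have /hB [u eu] := hP v hv; exists (row_mx u v).
    by rewrite mul_row_col mulmxBr mulmx1 !mulmxA -eu addrC subrK.
  rewrite -[w]hsubmxK mul_row_col mulmxBr mulmx1 !mulmxA; apply: K'D => //.
  by apply: hQ; apply/hB; exists (lsubmx w).
pose M : 'M[R]_(s + m, s + m') := block_mx 1%:M 0 N Q.
apply: fin_pres_ext (fin_pres_embed (M := M) _ (fin_pres_sum m fB)).
  move=> v; rewrite /lkernel; split=> [[w [hw ->]]|].
    rewrite -[w]hsubmxK mul_row_block mulmx0 add0r mulmx1 mul_row_col.
    rewrite mulmxDl !mulmxA hw mul0mx add0r -(mulmxA _ N) NB.
    by rewrite -!mulmxA -mulmxDr mulmxBl mulmxBr mulmx1 mul1mx !mulmxA addrA subrK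
      subrr mulmx0.
  set u := lsubmx v; set t := rsubmx v => e.
  have et : t = (t *m P - u *m B) *m Q.
    move: e; rewrite -[v]hsubmxK mul_row_col mulmxBr mulmx1 -/u -/t => /eqP.
    rewrite addrCA addr_eq0 => /eqP {1}->.
    by rewrite mulmxBl opprB !mulmxA.
  exists (row_mx (u - (t *m P - u *m B) *m N) (t *m P - u *m B)); split.
    rewrite /lkernel row_mxKl mulmxBl -mulmxA NB mulmxBr mulmx1 mulmxA -et.
    by rewrite opprB [t *m P - u *m B - t *m P]addrAC subrr sub0r subrr.
  by rewrite mul_row_block mulmx1 mulmx0 add0r subrK -et hsubmxK.
move=> w; rewrite /lkernel => hw.
rewrite -[w]hsubmxK mul_row_block mulmx0 add0r mulmx1.
rewrite -[X in _ = X]row_mx0 => /eq_row_mx [h1 h2].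
have t0 : rsubmx w = 0.
  have := congr1 (mulmx^~ B) h1.
  rewrite mulmxDl hw add0r -mulmxA NB mulmxBr mulmx1 mulmxA h2 !mul0mx sub0r.
  by move/eqP; rewrite oppr_eq0 => /eqP.
by move: h1; rewrite t0 mul0mx addr0 => ->; rewrite row_mx0.
Qed.

(** Two matrices with the same row span factor through each other, so Schanuel makes finiteness of
    the syzygies independent of the chosen generators. This takes the place of a Noetherian argument
    below. *)
Lemma fin_pres_kernel L m r (K : 'rV[R]_m -> Prop) (A : 'M[R]_(r, m)) :
  (forall v, K v <-> rowspan A v) -> fin_pres L.+1 K -> fin_pres L (lkernel A).
Proof.
move=> hA [s [B [hB fB]]].
have sub a b (C : 'M[R]_(a, m)) (D : 'M[R]_(b, m)) :
    (forall v, rowspan C v -> rowspan D v) -> exists P, C = P *m D.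
  move=> h; have [i|P hP] := @rowwise_choice _ a b (fun i w => row i C = w *m D).
    by apply: h; exists (delta_mx 0 i); rewrite rowE.
  by exists P; apply/row_matrixP => i; rewrite row_mul.
have [P eP] : exists P, A = P *m B by apply: sub => v /hA /hB.
have [Q eQ] : exists Q, B = Q *m A by apply: sub => v /hB /hA.
apply: (fin_pres_iso (P := P) (Q := Q) _ _ _ _ _ fB); rewrite /lkernel.
- by move=> v w hv hw; rewrite mulmxDl hv hw addr0.
- by move=> v hv; rewrite -mulmxA -eP.
- by move=> v hv; rewrite -mulmxA -eQ.
- by move=> v; rewrite mulmxBl -!mulmxA -eQ -eP subrr.
- by move=> v; rewrite mulmxBl -!mulmxA -eP -eQ subrr.
Qed.

End FinitePresentation.

Lemma least_nat (P : nat -> Prop) r :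
  P r -> exists s, P s /\ forall t, (t < s)%N -> ~ P t.
Proof.
elim/ltn_ind: r => r IH Pr.
case: (excluded_middle_informative (exists t, (t < r)%N /\ P t)) => [[t [lt Pt]]|h].
  exact: IH lt Pt.
by exists r; split=> // t lt Pt; apply: h; exists t.
Qed.

(** * Construction of minimal resolutions; Betti numbers and regularity *)

Section MinimalResolution.

Variables (k : fieldType) (n : nat).
Local Notation S := {mpoly k[n]}.

Lemma hcomp_sum b e (p : S) : (msize p + e <= b)%N -> \sum_(d < b) hcomp d e p = p.
Proof.
move=> hb; apply/mpolyP => m; rewrite raddf_sum /=.
rewrite (eq_bigr (fun d : 'I_b => if (mdeg m + e == d)%N then p@_m else 0)); last first.
  by move=> d _; rewrite mcoeff_hcomp.
rewrite -big_mkcond /=; have [hm|hm] := boolP (m \in msupp p); last first.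
  by rewrite big1 ?memN_msupp_eq0 // => d _; apply: memN_msupp_eq0.
have lt : (mdeg m + e < b)%N by have := msize_mdeg_lt hm; lia.
by rewrite (big_pred1 (Ordinal lt)) // => d; rewrite /= eq_sym.
Qed.

(** Every row is replaced by all its homogeneous components; [b] exceeds all degrees that occur, so
    the components sum to the row. *)
Lemma homog_generators m (dm : 'I_m -> nat) s (B : 'M[S]_(s, m)) :
  (forall D v, rowspan B v -> rowspan B (hcomp_mx (fun _ => D) dm v)) ->
  exists r (dr : 'I_r -> nat) (A : 'M[S]_(r, m)),
    homog_mx dr dm A /\ forall v, rowspan B v <-> rowspan A v.
Proof.
move=> gr.
pose b := (\max_(i < s) \max_(j < m) (msize (B i j) + dm j))%N.
have hb i j : (msize (B i j) + dm j <= b)%N.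
  apply: leq_trans (leq_bigmax i).
  exact: (leq_bigmax (F := fun j => msize (B i j) + dm j)%N).
pose T : finType := ('I_s * 'I_b)%type.
pose di (l : 'I_#|T|) : 'I_s := (enum_val l).1.
pose dr (l : 'I_#|T|) : nat := (enum_val l).2.
pose A : 'M[S]_(#|T|, m) :=
  \matrix_(l, j) hcomp (dr l) (dm j) (B (di l) j).
exists #|T|, dr, A; split=> [l j|v]; first by rewrite mxE; apply: homog_hcomp.
split=> [[w ->]|[w ->]].
  exists (\row_l w 0 (di l)); apply/rowP => j; rewrite !mxE.
  rewrite [RHS](eq_bigr (fun l : 'I_#|T| => w 0 (di l) *
      hcomp (dr l) (dm j) (B (di l) j))); last by move=> l _; rewrite !mxE.
  pose G (t : T) : S := w 0 t.1 * hcomp t.2 (dm j) (B t.1 j).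
  transitivity (\sum_(t : T) G t); last first.
    by rewrite (reindex _ (onW_bij _ (enum_val_bij T))).
  rewrite -(pair_bigA _ (fun i d => G (i, d))) /=; apply: eq_bigr => i _.
  by rewrite /G /= -mulr_sumr hcomp_sum.
have rA l : rowspan B (row l A).
  have -> : row l A =
      hcomp_mx (fun _ => dr l) dm (row (di l) B).
    by apply/rowP => j; rewrite !mxE.
  by apply: gr; exists (delta_mx 0 (di l)); rewrite rowE.
have [N hN] := @rowwise_choice _ #|T| s (fun l w => row l A = w *m B) rA.
by exists (w *m N); rewrite -mulmxA; congr (_ *m _); apply/row_matrixP => l; rewrite row_mul.
Qed.

(** Graded Nakayama: take the least number of homogeneous generators. A relation with a nonzero
    constant term in some coefficient would allow one generator to be dropped. *)
Lemma minimal_generators m (dm : 'I_m -> nat) s (B : 'M[S]_(s, m)) :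
  (forall D v, rowspan B v -> rowspan B (hcomp_mx (fun _ => D) dm v)) ->
  exists r (dr : 'I_r -> nat) (A : 'M[S]_(r, m)),
    [/\ homog_mx dr dm A, forall v, rowspan B v <-> rowspan A v
      & forall v, lkernel A v -> forall e, (v 0 e)@_0%MM = 0].
Proof.
move=> gr.
pose P r := exists (dr : 'I_r -> nat) (A : 'M[S]_(r, m)),
  homog_mx dr dm A /\ forall v, rowspan B v <-> rowspan A v.
have [r0 hr0] : exists r, P r by apply: homog_generators.
have [r [[dr [A [hA eA]]] rmin]] := least_nat hr0.
exists r, dr, A; split=> // v hv e; apply/eqP/negPn/negP => nz.
(* The component in the degree of generator [e] is still a relation, and its [e]-th coefficient is
   exactly the constant [c]. *)
pose w := hcomp_mx (fun _ => dr e) dr v.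
have hw : w *m A = 0.
  by rewrite -(hcomp_mxM _ _ hA) hv; apply/rowP => j; rewrite !mxE linear0.
pose c := (v 0 e)@_0%MM.
have we : w 0 e = c%:MP.
  apply/mpolyP => l; rewrite mxE mcoeff_hcomp mcoeffC -[X in _ == X]add0n eqn_add2r.
  by rewrite mdeg_eq0; case: eqP => [->|_]; rewrite ?mulr1 ?mulr0.
have {}nz : c != 0 by [].
case: r dr A hA eA rmin v hv e w hw c we nz => [|r] dr A hA eA rmin v hv e w hw c we nz.
  by case: e {c we w hw nz}.
apply: (rmin r) => //.
exists (dr \o lift e), (row' e A); split; first by move=> i j; rewrite mxE; apply: hA.
move=> u; rewrite eA; split=> [[x ->]|[x ->]].
  (* Adding this multiple of the relation [w] cancels the coefficient of generator [e] without
     changing the product with [A]. *)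
  pose y : S := - (c^-1)%:MP * x 0 e.
  exists (\row_i (x 0 (lift e i) + y * w 0 (lift e i))).
  have -> : x *m A = (x + y *: w) *m A by rewrite mulmxDl -scalemxAl hw scaler0 addr0.
  apply/rowP => j; rewrite !mxE (bigD1_ord e) //= !mxE we.
  have -> : x 0 e + y * c%:MP = 0.
    have cK : (c^-1)%:MP * c%:MP = 1 :> S by rewrite -mpolyCM mulVf.
    by rewrite mulrAC !mulNr cK mul1r subrr.
  by rewrite mul0r add0r; apply: eq_bigr => i _; rewrite !mxE.
exists (\row_i (if unlift e i is Some i' then x 0 i' else 0)).
apply/rowP => j; rewrite !mxE (bigD1_ord e) //= mxE unlift_none mul0r add0r.
by apply: eq_bigr => i _; rewrite !mxE liftK.
Qed.

(** The state of the inductive construction: the syzygy module still to be covered, with gradedness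
    and finiteness of every length so that the next kernel inherits both. *)
Record stage := Stage {
  st_rank : nat;
  st_deg : 'I_st_rank -> nat;
  st_mod : 'rV[S]_st_rank -> Prop;
  st_graded : forall D v, st_mod v -> st_mod (hcomp_mx (fun _ => D) st_deg v);
  st_fin : forall L, fin_pres L st_mod
}.

Definition covers (s : stage) (t : {t : stage & 'M[S]_(st_rank t, st_rank s)}) :=
  [/\ homog_mx (@st_deg (projT1 t)) (@st_deg s) (projT2 t),
      forall v, st_mod v <-> exists w, v = w *m projT2 t,
      forall v, @st_mod (projT1 t) v <-> v *m projT2 t = 0
    & forall v, @st_mod (projT1 t) v -> forall e, (v 0 e)@_0%MM = 0].

Lemma stage_cover (s : stage) : exists t, @covers s t.
Proof.
have [r [B [hB _]]] := st_fin s 1.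
have gr D v : rowspan B v -> rowspan B (hcomp_mx (fun _ => D) (@st_deg s) v).
  by move=> /hB h; apply/hB; apply: st_graded.
have [q [dq [A [hA eA mA]]]] := minimal_generators gr.
have sA v : st_mod v <-> rowspan A v by rewrite hB eA.
have gK D v : lkernel A v -> lkernel A (hcomp_mx (fun _ => D) dq v).
  move=> h; rewrite /lkernel -(hcomp_mxM _ _ hA) h.
  by apply/rowP => j; rewrite !mxE linear0.
have fK L : fin_pres L (lkernel A) by apply: fin_pres_kernel sA (st_fin s L.+1).
by exists (existT _ (Stage gK fK) A).
Qed.

(** The resolution [F] serves only to provide finiteness. The new one starts from S itself with
    augmentation 1 and covers [I], then each kernel, by minimal generators; absence of constant
    terms in [I] gives minimality of the first map. *)
Lemma minimal_resolution_exists (I : S -> Prop) (F : free_complex k n) :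
  homog_ideal I -> (forall p, I p -> p@_0%MM = 0) -> resolves I F ->
  exists M, minimal_graded_free_resolution I M.
Proof.
move=> hI I0 rF; have [surF exF0 exF] := rF.
have fker L i : fin_pres L (lkernel (fdiff F i)).
  elim: L i => //= L IH i; exists (frank F i.+2), (fdiff F i.+1).
  by split=> [v|]; [apply: exF | apply: IH].
have f0 L : fin_pres L (fun v => I (@aug_val _ _ F v)).
  case: L => //= L; exists (frank F 1), (fdiff F 0).
  by split=> [v|]; [apply: exF0 | apply: fker].
pose K (v : 'rV[S]_1) := I (v 0 0).
(* Since [u] has augmentation 1 modulo [I], the maps [u] and [faug F] are mutually inverse on the
   two presentations of S/I, as Schanuel requires. *)
have [u hu] := surF 1.
have fK L : fin_pres L K.
  apply: (fin_pres_iso (P := u) (Q := faug F) _ _ _ _ _ (f0 L)).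
  - by move=> v w hv hw; rewrite /K mxE; apply: idealD.
  - move=> v hv; have -> : v *m u = v 0 0 *: u.
      by apply/rowP => j; rewrite !mxE big_ord1.
    by rewrite aug_valZ mulrC; apply: idealM.
  - by [].
  - move=> v; have -> : v - v *m u *m faug F = v *m (1%:M - u *m faug F).
      by rewrite mulmxBr mulmx1 mulmxA.
    by apply: ideal_mulmx => // a b; rewrite !ord1 !mxE; rewrite /aug_val mxE in hu.
  - move=> v; rewrite /aug_val mulmxBl.
    have -> : v *m faug F *m u *m faug F - v *m faug F =
       - ((v *m faug F) *m (1%:M - u *m faug F)).
      by rewrite mulmxBr mulmx1 opprB mulmxA.
    rewrite mxE; apply: idealN => //.
    by apply: ideal_mulmx => // a b; rewrite !ord1 !mxE; rewrite /aug_val mxE in hu.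
have gK D v : K v -> K (hcomp_mx (fun _ => D) (fun _ : 'I_1 => 0) v).
  by rewrite /K mxE => h; apply: ideal_hcomp.
pose next s := constructive_indefinite_description _ (stage_cover s).
pose stages := fix stages i : stage :=
  match i with 0 => Stage gK fK | j.+1 => projT1 (sval (next (stages j))) end.
have hnext i := svalP (next (stages i)).
pose M : free_complex k n :=
  {| frank := fun i => st_rank (stages i); fgdeg := fun i => @st_deg (stages i);
     fdiff := fun i => projT2 (sval (next (stages i)));
     faug := 1%:M : 'cV[S]_(st_rank (stages 0)) |}.
have augM (v : 'rV[S]_1) : @aug_val _ _ M v = v 0 0.
  by rewrite /aug_val /= mulmx1.
exists M; split.
- split=> [i a b|a]; first by have [h _ _ _] := hnext i; apply: h.
  rewrite /= mxE ord1 => m; rewrite msupp1 inE => /eqP ->.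
  by rewrite mdeg0.
- split=> [p|v|i v].
  + exists (const_mx p : 'rV[S]_1); rewrite augM mxE subrr; exact: ideal0.
  + rewrite augM; have [_ h _ _] := hnext 0; exact: h.
  + have [_ _ h _] := hnext i; have [_ h' _ _] := hnext i.+1.
    by rewrite -[v *m _ = 0]/(v *m projT2 (sval (next (stages i))) = 0) -h; exact: h'.
- case=> [|i] a b.
    apply: I0; have [_ h _ _] := hnext 0.
    have /h : exists w, row a (fdiff M 0) = w *m projT2 (sval (next (stages 0))).
      by exists (delta_mx 0 a); rewrite rowE.
    by rewrite /= /K mxE ord1.
  have [_ _ _ h] := hnext i; have [_ h' _ _] := hnext i.+1.
  have /h' /h : exists w, row a (fdiff M i.+1) = w *m projT2 (sval (next (stages i.+1))).
    by exists (delta_mx 0 a); rewrite rowE.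
  by move=> /(_ b); rewrite mxE.
Qed.

Lemma betti_spec (I : S -> Prop) (F : free_complex k n) i j :
  homog_ideal I -> (forall p, I p -> p@_0%MM = 0) -> resolves I F ->
  exists M, minimal_graded_free_resolution I M /\
    betti I i j = #|[set a : 'I_(frank M i) | fgdeg a == j]|.
Proof.
move=> hI I0 rF; have [M hM] := minimal_resolution_exists hI I0 rF.
have [|M' [hM' eM']] := epsilon_spec (inhabits 0%N)
    (fun b => exists F : free_complex k n, minimal_graded_free_resolution I F /\
       b = #|[set a : 'I_(frank F i) | fgdeg a == j]|).
  by exists #|[set a : 'I_(frank M i) | fgdeg a == j]|, M.
by exists M'.
Qed.

(** In a minimal resolution every row and column is unit-free, so each of its degrees occurs in any
    graded resolution. Upper bounds on the regularity can thus be read off a non-minimal [F]. *)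
Lemma betti_neq0 (I : S -> Prop) (F : free_complex k n) i j :
  homog_ideal I -> (forall p, I p -> p@_0%MM = 0) ->
  graded_complex F -> resolves I F -> betti I i j <> 0%N ->
  exists a : 'I_(frank F i), fgdeg a = j.
Proof.
move=> hI I0 gF rF.
have [M' [[gM' rM' mM'] ->]] := betti_spec i j hI I0 rF.
move=> /eqP; rewrite cards_eq0 => /set0Pn [a]; rewrite inE => /eqP <-.
apply: (minimal_generator_degree hI gM' gF rM' rF) => [|b]; last exact: mM'.
by case: i a => //= i a b; apply: mM'.
Qed.

Lemma betti_unit_free (I : S -> Prop) (F : free_complex k n) i (a : 'I_(frank F i)) :
  homog_ideal I -> (forall p, I p -> p@_0%MM = 0) ->
  graded_complex F -> resolves I F -> unit_free_row a -> unit_free_col a ->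
  betti I i (fgdeg a) <> 0%N.
Proof.
move=> hI I0 gF rF ra ca; set j := fgdeg a.
have [M' [[gM' rM' mM'] ->]] := betti_spec i j hI I0 rF.
have [b hb] := minimal_generator_degree hI gF gM' rF rM' ra ca.
by move=> /eqP; rewrite cards_eq0 => /set0Pn []; exists b; rewrite inE hb.
Qed.

(** The degree bound and the surviving generator show that [r] satisfies [is_reg]; a maximum is
    unique, so the value picked by [epsilon] is [r]. *)
Lemma reg_quotient_attains (I : S -> Prop) r :
  homog_ideal I -> (forall p, I p -> p@_0%MM = 0) -> attains I r ->
  reg_quotient I = r%:Z.
Proof.
move=> hI I0 [F [gF rF bF [p [a [da ra ca]]]]].
have hr : is_reg I r%:Z.
  split=> [|i j /(betti_neq0 hI I0 gF rF) [b <-]].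
    exists p, (fgdeg a); split; first exact: betti_unit_free.
    by rewrite da PoszD addrAC subrr add0r.
  by rewrite lerBlDl -PoszD lez_nat; apply: bF.
have [[i [j [hij eij]]] ub] : is_reg I (reg_quotient I).
  by apply: epsilon_spec; exists r%:Z.
have [[i' [j' [hij' eij']]] ub'] := hr.
apply/eqP; rewrite eq_le -{1}eij -{2}eij' ub //.
by rewrite ub'.
Qed.

End MinimalResolution.

(** * Ideals generated by edges and variables *)

Section MonomialIdeals.

Variables (k : fieldType) (n : nat).
Local Notation S := {mpoly k[n]}.
Implicit Types (Q : pred 'X_{1..n}) (p : S).

(** For [Q] closed under multiples this is the monomial ideal spanned by [Q]; colons and added
    variables become conditions on exponents. *)
Definition mono_ideal Q p := forall m, m \in msupp p -> Q m.

Lemma mono_idealD Q p q : mono_ideal Q p -> mono_ideal Q q -> mono_ideal Q (p + q).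
Proof. by move=> hp hq m /msuppD_le; rewrite mem_cat => /orP [/hp|/hq]. Qed.

Lemma mono_ideal_sum Q (T : eqType) (r : seq T) (F : T -> S) :
  {in r, forall i, mono_ideal Q (F i)} -> mono_ideal Q (\sum_(i <- r) F i).
Proof.
move=> h; rewrite big_seq; apply: (big_ind (mono_ideal Q)) => //.
- by move=> m; rewrite msupp0.
- by move=> p q; apply: mono_idealD.
Qed.

Lemma mono_ideal_homog Q : (forall m l, Q m -> Q (l + m)%MM) ->
  homog_ideal (mono_ideal Q).
Proof.
move=> up; split.
- by move=> m; rewrite msupp0.
- exact: mono_idealD.
- move=> p q hq m /msuppM_le /allpairsP [[a b] [/= _ hb ->]].
  exact/up/hq.
- move=> a b p hp m; rewrite mcoeff_msupp mcoeff_hcomp.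
  by case: ifP; rewrite ?eqxx // -mcoeff_msupp => _ /hp.
Qed.

Lemma colon_monoE Q v p :
  mono_ideal (fun m => Q (m + U_(v))%MM) p <-> colon (mono_ideal Q) 'X_v p.
Proof.
rewrite /colon; split=> h m.
  by rewrite (perm_mem (msuppMX _ _)) => /mapP [l /h hl ->]; rewrite addmC.
move=> hm; apply: h; rewrite (perm_mem (msuppMX _ _)).
by apply/mapP; exists m => //; rewrite addmC.
Qed.

Lemma adjoin_monoE Q v p : (forall m l, Q m -> Q (l + m)%MM) ->
  mono_ideal (fun m => Q m || (0 < m v)%N) p <-> adjoin (mono_ideal Q) 'X_v p.
Proof.
move=> up; have hI := mono_ideal_homog up; split=> [h|[q hq] m].
  (* The terms divisible by the variable, divided by it. *)
  exists (\sum_(m <- msupp p | (0 < m v)%N) p@_m *: 'X_[m - U_(v)]).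
  rewrite {1}[p]mpolyE (bigID (fun m : 'X_{1..n} => (0 < m v)%N)) /=.
  rewrite [X in _ - X]mulr_suml [X in X + _ - _](eq_bigr
    (fun m : 'X_{1..n} => p@_m *: 'X_[m - U_(v)] * 'X_v)); last first.
    move=> m hm; rewrite -scalerAl -mpolyXD submK //.
    by rewrite lep1mP -lt0n.
  rewrite addrAC subrr add0r -big_filter; apply: mono_ideal_sum => m.
  rewrite mem_filter => /andP [hv hm] l /msuppZ_le.
  rewrite msuppX inE => /eqP ->.
  by have := h m hm; rewrite (negPf hv) orbF.
have -> : p = (p - q * 'X_v) + q * 'X_v by rewrite subrK.
move=> /msuppD_le; rewrite mem_cat => /orP [/hq ->//|].
rewrite (perm_mem (msuppMX _ _)) => /mapP [l _ ->].
by rewrite mnmDE mnm1E eqxx orbT.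
Qed.

End MonomialIdeals.

(** * Edge ideals as monomial ideals *)

Section GraphIdeals.

Variables (k : fieldType) (n : nat).
Local Notation S := {mpoly k[n]}.
Implicit Types (e : rel 'I_n) (V : {set 'I_n}) (m : 'X_{1..n}).

Definition graph_mono e V m :=
  [exists v in V, (0 < m v)%N] ||
  [exists i, exists j, [&& e i j, (0 < m i)%N & (0 < m j)%N]].

Definition graph_ideal e V : S -> Prop := mono_ideal (graph_mono e V).

Lemma graph_monoP e V m :
  reflect ((exists2 v, v \in V & (0 < m v)%N) \/
           exists i j, [/\ e i j, (0 < m i)%N & (0 < m j)%N])
    (graph_mono e V m).
Proof.
apply: (iffP orP) => [] [].
- by move=> /exists_inP h; left.
- by move=> /existsP [i /existsP [j /and3P h]]; right; exists i, j.
- by move=> h; left; apply/exists_inP.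
- by move=> [i [j [h1 h2 h3]]]; right; apply/existsP; exists i; apply/existsP; exists j;
    apply/and3P.
Qed.

Lemma graph_mono_up e V m l : graph_mono e V m -> graph_mono e V (l + m)%MM.
Proof.
move=> /graph_monoP h; apply/graph_monoP; case: h => [[v hv mv]|[i [j [hij hi hj]]]].
  by left; exists v => //; rewrite mnmDE addn_gt0 mv orbT.
by right; exists i, j; rewrite !mnmDE !addn_gt0 hi hj !orbT.
Qed.

Lemma graph_ideal_homog e V : homog_ideal (graph_ideal e V).
Proof. exact/mono_ideal_homog/graph_mono_up. Qed.

Lemma graph_ideal_proper e p : graph_ideal e set0 p -> p@_0%MM = 0.
Proof.
move=> h; apply/eqP; rewrite mcoeff_eq0; apply/negP => /h /graph_monoP [[v]|].
  by rewrite inE.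
by move=> [i [j []]]; rewrite mnm0E.
Qed.

(** Irreflexivity matters: at a loop [graph_mono] would ask for the variable only once, whereas the
    generator is its square. *)
Lemma edge_idealE e p : irreflexive e -> edge_ideal e p <-> graph_ideal e set0 p.
Proof.
move=> irr; split=> [[c ->]|h].
  have hI := graph_ideal_homog e set0.
  apply: (big_ind (graph_ideal e set0)) => [|q q'|i _]; [exact: (ideal0 hI)|exact: (idealD hI)|].
  apply: (big_ind (graph_ideal e set0)) => [|q q'|j hij]; [exact: (ideal0 hI)|exact: (idealD hI)|].
  apply: (idealM hI); rewrite -mpolyXD => m; rewrite msuppX inE => /eqP ->.
  apply/graph_monoP; right; exists i, j.
  by split; rewrite // mnmDE !mnm1E eqxx addn_gt0 ?orbT.
have E0 : edge_ideal e (0 : S).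
  by exists (fun _ _ => 0); rewrite big1 // => i _; rewrite big1 // => j _; rewrite mul0r.
have ED (q q' : S) : edge_ideal e q -> edge_ideal e q' -> edge_ideal e (q + q').
  move=> [c ->] [c' ->]; exists (fun i j => c i j + c' i j).
  rewrite -big_split; apply: eq_bigr => i _ /=; rewrite -big_split.
  by apply: eq_bigr => j _ /=; rewrite mulrDl.
rewrite [p]mpolyE big_seq; apply: (big_ind (@edge_ideal k n e)) => // m.
move=> /h /graph_monoP [[v]|[i [j [hij hi hj]]]]; first by rewrite inE.
move: (p@_m) => x.
have ij : i != j by apply: contraTneq hij => ->; rewrite irr.
exists (fun a b => if (a == i) && (b == j) then x *: 'X_[m - U_(i) - U_(j)] else 0).
rewrite (bigD1 i) //= (bigD1 j) //= !eqxx /= big1; last first.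
  by move=> b /andP [_ /negPf ->]; rewrite mul0r.
rewrite big1 => [|a /negPf ha]; last first.
  by rewrite big1 // => b _; rewrite ha mul0r.
rewrite !addr0 -scalerAl; congr (_ *: _).
rewrite -!mpolyXD; congr 'X_[_]; apply/mnmP => l.
rewrite !(mnmDE, mnmBE, mnm1E).
move: ij hi hj; rewrite -val_eqE /=.
case: (i =P l) => [->|_]; case: (j =P l) => [->|_] //=; lia.
Qed.

End GraphIdeals.

(** * Corners for edgeless graphs, paths and matchings *)

Section GraphCorners.

Variables (k : fieldType) (n : nat).
Local Notation S := {mpoly k[n]}.
Implicit Types (e : rel 'I_n) (V : {set 'I_n}).
Local Notation gcorner e V p r := (corner (@graph_ideal k n e V) p r).

Lemma resolves_ext (I J : S -> Prop) (F : free_complex k n) :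
  (forall p, I p <-> J p) -> resolves I F -> resolves J F.
Proof.
move=> e [h1 h2 h3]; split=> // [p|v]; last by rewrite -e.
by have [v hv] := h1 p; exists v; apply/e.
Qed.

Lemma corner_ext (I J : S -> Prop) p r :
  (forall q, I q <-> J q) -> corner I p r -> corner J p r.
Proof. by move=> e [F [gF /(resolves_ext e) rF bF zF cF]]; exists F. Qed.

Lemma attains_ext (I J : S -> Prop) r :
  (forall q, I q <-> J q) -> attains I r -> attains J r.
Proof. by move=> e [F [gF /(resolves_ext e) rF bF cF]]; exists F. Qed.

Lemma mono_ideal_ext (Q Q' : pred 'X_{1..n}) (p : S) :
  Q =1 Q' -> mono_ideal Q p <-> mono_ideal Q' p.
Proof. by move=> e; split=> h m /h; rewrite e. Qed.

Lemma homog_var v : homog_diff ('X_v : S) 1 0.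
Proof. by move=> m; rewrite msuppX inE => /eqP ->; rewrite mdeg1. Qed.

Definition neighbours e v : {set 'I_n} := [set w | e v w].

Lemma graph_colonE e V v (p : S) : ssrbool.symmetric e -> irreflexive e -> v \notin V ->
  graph_ideal e (V :|: neighbours e v) p <-> colon (graph_ideal e V) 'X_v p.
Proof.
move=> sym irr hv; rewrite -colon_monoE; apply: mono_ideal_ext => m.
have up : (m + U_(v))%MM = (U_(v) + m)%MM by rewrite addmC.
apply/graph_monoP/graph_monoP => [[[w]|[i [j [hij hi hj]]]]|[[w hw]|[i [j [hij]]]]].
- rewrite !inE => /orP [hw mw|hvw mw]; [left|right].
    by exists w => //; rewrite up mnmDE addn_gt0 mw orbT.
  by exists v, w; rewrite up !mnmDE !addn_gt0 mw mnm1E eqxx orbT.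
- by right; exists i, j; rewrite up !mnmDE !addn_gt0 hi hj !orbT.
- rewrite mnmDE mnm1E; case: eqP => [vw|_]; first by rewrite vw hw in hv.
  by rewrite addn0 => mw; left; exists w => //; rewrite inE hw.
- rewrite !mnmDE !mnm1E; case: (v =P i) => [vi|_].
    case: (v =P j) => [vj|_]; first by rewrite -vi -vj irr in hij.
    by rewrite addn0 => _ mj; left; exists j => //; rewrite !inE vi hij orbT.
  rewrite addn0 => mi; case: (v =P j) => [vj|_].
    by left; exists i => //; rewrite !inE vj sym hij orbT.
  by rewrite addn0 => mj; right; exists i, j.
Qed.

Lemma graph_adjoinE e V v (p : S) :
  graph_ideal e (v |: V) p <-> adjoin (graph_ideal e V) 'X_v p.
Proof.
rewrite -adjoin_monoE; last exact: graph_mono_up.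
apply: mono_ideal_ext => m.
apply/graph_monoP/orP => [[[w]|h]|[/graph_monoP [[w hw mw]|h]|mv]].
- rewrite !inE => /orP [/eqP -> mv|hw mw]; [by right|left].
  by apply/graph_monoP; left; exists w.
- by left; apply/graph_monoP; right.
- by left; exists w; rewrite // !inE hw orbT.
- by right.
- by left; exists v; rewrite // !inE eqxx.
Qed.

(** A vertex with all neighbours in [V] has colon ideal equal to the ideal itself, so its variable
    is regular and the cone applies. *)
Lemma gcorner_isolated e V v p r : ssrbool.symmetric e -> irreflexive e -> v \notin V ->
  neighbours e v \subset V -> gcorner e V p r -> gcorner e (v |: V) p.+1 r.
Proof.
move=> sym irr hv /setUidPl hN h.
apply: corner_ext (fun q => iff_sym (graph_adjoinE e V v q)) _.
apply: corner_adjoin_regular h; [exact: graph_ideal_homog|exact: homog_var|].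
by move=> q; rewrite -{2}hN graph_colonE.
Qed.

Lemma gcorner_colon e V v p p' r r' : ssrbool.symmetric e -> irreflexive e -> v \notin V ->
  (p' <= p)%N -> (r' <= r.+1)%N -> gcorner e (V :|: neighbours e v) p r ->
  gcorner e (v |: V) p' r' -> gcorner e V p r.+1.
Proof.
move=> sym irr hv hp hr h h'.
apply: (@corner_of_colon k n _ 'X_v p p' r r' _ _ hp hr).
- exact: graph_ideal_homog.
- exact: homog_var.
- by apply: corner_ext h => q; apply: graph_colonE.
- by apply: corner_ext h' => q; apply: graph_adjoinE.
Qed.

Lemma attains_graph_adjoin e V v p p' r r' : ssrbool.symmetric e -> irreflexive e ->
  v \notin V -> (r < r')%N -> gcorner e (V :|: neighbours e v) p r ->
  gcorner e (v |: V) p' r' -> attains (@graph_ideal k n e V) r'.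
Proof.
move=> sym irr hv hr h h'.
apply: (@attains_of_adjoin k n _ 'X_v p' r r' p _ _ hr).
- exact: graph_ideal_homog.
- exact: homog_var.
- by apply: corner_ext h => q; apply: graph_colonE.
- by apply: corner_ext h' => q; apply: graph_adjoinE.
Qed.

Lemma gcorner_trivial : gcorner (fun _ _ => false) set0 0 0.
Proof.
pose F : free_complex k n :=
  {| frank := fun i => if i is 0 then 1%N else 0%N; fgdeg := fun _ _ => 0%N;
     fdiff := fun _ => 0; faug := 1%:M |}.
have augF (v : 'rV[S]_1) : @aug_val _ _ F v = v 0 0 by rewrite /aug_val /= mulmx1.
have zI p : graph_ideal (fun _ _ => false) set0 p <-> p = 0.
  split=> [h|-> m]; last by rewrite msupp0.
  apply/msuppnil0; case E : (msupp p) => [|m s] //.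
  have /h /graph_monoP [[v]|[i [j []]]] // : m \in msupp p by rewrite E mem_head.
  by rewrite inE.
exists F; split.
- split=> [i a b|a m]; first by rewrite mxE; apply: homog_diff0.
  by rewrite /= mxE !ord1 msupp1 inE => /eqP ->; rewrite mdeg0.
- split=> [p|v|i v].
  + by exists (const_mx p : 'rV[S]_1); rewrite augF mxE subrr; apply/zI.
  + change ('rV[S]_1) in v; rewrite augF zI; split=> [h|[w ->]].
      exists 0; rewrite mul0mx; apply/rowP => j.
      by rewrite ord1 h mxE.
    by rewrite mulmx0 mxE.
  + change ('rV[S]_0) in v; split=> _; last by rewrite mulmx0.
    by exists 0; rewrite mul0mx; apply/rowP => - [].
- by move=> [|i] a.
- by case.
by exists ord0.
Qed.

(** The ideal is generated by the variables in [V]; adding them one at a time builds the Koszul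
    complex. *)
Lemma gcorner_edgeless e V : (forall i j, e i j -> (i \in V) || (j \in V)) ->
  gcorner e V #|V| 0.
Proof.
move=> hV.
suff h : gcorner (fun _ _ => false) V #|V| 0.
  apply: corner_ext h => q; apply: mono_ideal_ext => m.
  apply/graph_monoP/graph_monoP => [[h|[i [j []]]]|[h|[i [j [/hV /orP [hi|hj] mi mj]]]]];
    left => //; by [exists i | exists j].
move: {2}#|V| (leqnn #|V|) => d; elim: d {hV} V => [|d IH] V.
  by rewrite leqn0 cards_eq0 => /eqP ->; rewrite cards0; apply: gcorner_trivial.
have [->|[v hv]] := set_0Vmem V; first by rewrite cards0; move=> _; apply: gcorner_trivial.
rewrite (cardsD1 v) hv add1n ltnS => /IH h.
rewrite -{1}(setD1K hv); apply: gcorner_isolated h => //; first by rewrite setD11.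
by apply/subsetP => w; rewrite inE.
Qed.

(* The ideal of e and V defines the graph induced on the complement of V, so both
   lemmas below describe that induced graph. *)

(* With x the vertex next to the end of the path, the colon by x is a path with three
   vertices fewer plus two variables, and adding x leaves a path with two fewer. *)
Lemma gcorner_path e m V : ssrbool.symmetric e -> irreflexive e -> (m <= n)%N ->
  (forall i : 'I_n, (i < m)%N -> i \notin V) ->
  (forall i j, i \notin V -> j \notin V ->
     e i j = [&& (j == i.+1 :> nat) || (i == j.+1 :> nat), i < m & j < m]%N) ->
  gcorner e V (2 * m %/ 3 + #|V|) (m.+1 %/ 3).
Proof.
move=> sym irr; elim/ltn_ind: m V => m IH V mn hm he.
have [m1|m1] := leqP m 1.
  have -> : (2 * m %/ 3 + #|V| = #|V|)%N by lia.
  have -> : (m.+1 %/ 3 = 0)%N by lia.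
  apply: gcorner_edgeless => i j hij; apply: contraLR hij; rewrite negb_or => /andP [hi hj].
  rewrite he //; lia.
have lt x : (x < m -> x < n)%N by move=> h; apply: leq_trans h mn.
have lx : (m - 2 < n)%N by apply: lt; lia.
have lz : (m - 1 < n)%N by apply: lt; lia.
pose x := Ordinal lx; pose z := Ordinal lz.
have hx : x \notin V by apply: hm => /=; lia.
have hz : z \notin V by apply: hm => /=; lia.
have nE (i : 'I_n) a (la : (a < n)%N) : (i == Ordinal la) = (i == a :> nat) by [].
have adj : gcorner e (x |: V) (2 * (m - 2) %/ 3 + #|x |: V|) ((m - 2).+1 %/ 3).
  apply: IH; [lia|lia| |].
    move=> i hi; rewrite !inE negb_or hm ?andbT ?nE; lia.
  move=> i j; rewrite !inE !negb_or !nE => /andP [ix iV] /andP [jx jV].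
  rewrite he //; lia.
have [m2|m2] := leqP m 2.
  have eN : V :|: neighbours e x = z |: V.
    apply/setP => w; rewrite !inE orbC.
    have [//|hw] := boolP (w \in V); rewrite ?orbT //.
    rewrite !orbF he // nE /=; lia.
  have col : gcorner e (V :|: neighbours e x)
      (2 * 0 %/ 3 + #|V :|: neighbours e x|) (1 %/ 3).
    apply: IH; [lia|lia|by []|].
    rewrite eN => i j; rewrite !inE !negb_or !nE => /andP [ix iV] /andP [jx jV].
    rewrite he //; lia.
  have -> : (2 * m %/ 3 + #|V| = 2 * 0 %/ 3 + #|V :|: neighbours e x|)%N.
    by rewrite eN cardsU1 hz; lia.
  have -> : (m.+1 %/ 3 = (1 %/ 3).+1)%N by lia.
  apply: (gcorner_colon sym irr hx _ _ col adj); last lia.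
  by rewrite eN !cardsU1 hx hz leq_add2r leq_div2r //; lia.
have ly : (m - 3 < n)%N by apply: lt; lia.
pose y := Ordinal ly.
have hy : y \notin V by apply: hm => /=; lia.
have eN : V :|: neighbours e x = y |: (z |: V).
  apply/setP => w; rewrite !inE orbC; have [//|hw] := boolP (w \in V); rewrite ?orbT //.
  rewrite !orbF he // !nE /=; lia.
have hyz : y \notin z |: V by rewrite !inE negb_or hy nE /= andbT; lia.
have col : gcorner e (y |: (z |: V)) (2 * (m - 3) %/ 3 + #|y |: (z |: V)|) ((m - 3).+1 %/ 3).
  apply: IH; [lia|lia| |].
    move=> i hi; rewrite !inE !negb_or hm ?andbT ?nE; lia.
  move=> i j; rewrite !inE !negb_or !nE => /and3P [iy iz iV] /and3P [jy jz jV].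
  rewrite he //; lia.
rewrite -eN in col.
have -> : (2 * m %/ 3 + #|V| = 2 * (m - 3) %/ 3 + #|V :|: neighbours e x|)%N.
  by rewrite eN !cardsU1 hyz hz; lia.
have -> : (m.+1 %/ 3 = ((m - 3).+1 %/ 3).+1)%N by lia.
(* The branch adding [x] has length floor(2(m-2)/3) + |V| + 1, which does not exceed that of the
   colon branch. *)
apply: (gcorner_colon sym irr hx _ _ col adj); last lia.
by rewrite eN !cardsU1 hx hyz hz; lia.
Qed.

(** Smaller endpoints: when the induced graph is a matching, each edge is counted once. *)
Definition edge_sources e V : {set 'I_n} :=
  [set i | (i \notin V) && [exists j, [&& j \notin V, (i < j)%N & e i j]]].

(** These are the invariants of a complete intersection of |V| linear and g quadratic forms. For an
    edge ab, the colon by [a] removes [b] and adding [a] removes [a]; both leave g - 1 edges and the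
    same corner. *)
Lemma gcorner_matching e V : ssrbool.symmetric e -> irreflexive e ->
  (forall i j l, i \notin V -> j \notin V -> l \notin V ->
     e i j -> e i l -> j = l) ->
  gcorner e V (#|V| + #|edge_sources e V|) #|edge_sources e V|.
Proof.
move=> sym irr; move eg : #|edge_sources e V| => g.
elim: g V eg => [|g IH] V eg uniqE.
  rewrite addn0; apply: gcorner_edgeless => i j hij.
  move/eqP: eg; rewrite cards_eq0 => /eqP E0.
  have no a b : a \notin V -> b \notin V -> e a b -> (a < b)%N -> False.
    move=> ha hb hab lab; have : a \in edge_sources e V.
      by rewrite inE ha; apply/existsP; exists b; rewrite hb lab.
    by rewrite E0 inE.
  have [//|hi] := boolP (i \in V); have [//|hj] := boolP (j \in V).
  have [lt|lt|/ord_inj eij] := ltngtP i j.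
  - by case: (no i j).
  - by case: (no j i) => //; rewrite sym.
  - by rewrite eij irr in hij.
have [a ha] : exists a, a \in edge_sources e V.
  by apply/set0Pn; rewrite -card_gt0 eg.
have := ha; rewrite inE => /andP [aV /existsP [b /and3P [bV lab hab]]].
have eN : V :|: neighbours e a = b |: V.
  apply/setP => w; rewrite !inE orbC; have [//|hw] := boolP (w \in V); rewrite ?orbT //.
  rewrite !orbF; apply/idP/eqP => [h|->] //; exact: uniqE hab.
have card1 : #|edge_sources e V :\ a| = g by move: eg; rewrite (cardsD1 a) ha; case.
(* Deleting [x] from the edge xy removes exactly the source [a], whichever endpoint [a] is. *)
have srcE x y : x \notin V -> y \notin V -> e x y ->
    (forall i j, i \in edge_sources e V -> i != a -> j \notin V -> (i < j)%N -> e i j ->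
       (i != x) && (j != x)) ->
    x = a \/ y = a ->
    edge_sources e (x |: V) = edge_sources e V :\ a.
  move=> xV yV hxy hne hxya; apply/setP => i; rewrite !inE negb_or.
  apply/idP/idP.
    move=> /andP [/andP [ix iV] /existsP [j]]; rewrite !inE negb_or => /and3P [/andP [jx jV] lij hij].
    apply/and3P; split=> //; last by apply/existsP; exists j; rewrite jV lij.
    case: hxya => [<- //|eya]; apply: contraNneq jx => eia; apply/eqP.
    by apply: (uniqE i) => //; rewrite eia sym -eya.
  move=> /and3P [ia iV /existsP [j /and3P [jV lij hij]]].
  have iE : i \in edge_sources e V by rewrite inE iV; apply/existsP; exists j; rewrite jV lij.
  have /andP [ix jx] := hne i j iE ia jV lij hij.
  by rewrite ix iV; apply/existsP; exists j; rewrite !inE negb_or jx jV lij.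
have Ea : edge_sources e (a |: V) = edge_sources e V :\ a.
  apply: (srcE a b) => //; last by left.
  move=> i j; rewrite inE => /andP [iV _] ia jV lij hij; rewrite ia /=.
  apply: contraTneq lab => eja; rewrite -leqNgt -eja.
  have -> : b = i by apply: (uniqE a) => //; rewrite sym -eja.
  exact: ltnW.
have Eb : edge_sources e (b |: V) = edge_sources e V :\ a.
  apply: (srcE b a) => //; [by rewrite sym| |by right].
  move=> i j; rewrite inE => /andP [iV _] ia jV lij hij; apply/andP; split.
    apply: contraTneq lij => eib; rewrite -leqNgt eib.
    have -> : j = a by apply: (uniqE b) => //; [rewrite -eib|rewrite sym].
    exact: ltnW.
  apply: contraNneq ia => ejb; apply/eqP.
  by apply: (uniqE b) => //; rewrite sym // -ejb.
have uniqU x : forall i j l, i \notin x |: V -> j \notin x |: V -> l \notin x |: V ->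
    e i j -> e i l -> j = l.
  move=> i j l; rewrite !inE !negb_or => /andP [_ iV] /andP [_ jV] /andP [_ lV].
  exact: uniqE.
have ca : gcorner e (a |: V) (#|a |: V| + g) g by apply: IH; [rewrite Ea | exact: uniqU].
have cb : gcorner e (b |: V) (#|b |: V| + g) g by apply: IH; [rewrite Eb | exact: uniqU].
move: ca cb; rewrite !cardsU1 aV bV add1n addSn addnS => ca cb.
by apply: (gcorner_colon sym irr aV (leqnn _) _ _ ca); rewrite ?eN.
Qed.

End GraphCorners.

(** * Suspensions of paths *)

Section MaximalIndependentSetsOfPaths.

Variables (c : pred nat) (n : nat).
Hypothesis c_lt : forall i, c i -> (i < n)%N.
Hypothesis c_indep : forall i, c i -> ~~ c i.+1.
Hypothesis c_max : forall i, (i < n)%N -> ~~ c i -> ((0 < i)%N && c i.-1) || c i.+1.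

(** For m = n - 1 this counts the edges of the path with both ends outside the independent set. *)
Definition gaps m : nat := \sum_(i < m) (~~ c i && ~~ c i.+1).

Lemma gapsS m : gaps m.+1 = (gaps m + (~~ c m && ~~ c m.+1))%N.
Proof. by rewrite /gaps big_ord_recr. Qed.

(** Consecutive members of [c] are 2 or 3 apart, and a step contains one gap exactly when it is 3.
    Equality forces the start at 0 and all steps equal to 3. *)
Lemma gaps_le j : c j ->
  (3 * gaps j <= j)%N /\ (3 * gaps j = j -> forall i, (i <= j)%N -> c i = (3 %| i)%N).
Proof.
have g0 : gaps 0 = 0%N by rewrite /gaps big_ord0.
elim/ltn_ind: j => j IH cj.
have [j0|j0] := posnP j.
  by rewrite j0 in cj *; rewrite g0; split=> // _ i; rewrite leqn0 => /eqP ->; rewrite cj.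
have nc1 : ~~ c j.-1.
  by apply/negP => /c_indep; rewrite prednK // cj.
have e1 : gaps j = gaps j.-1 by rewrite -{1}(prednK j0) gapsS prednK // cj andbF addn0.
have [j1|j1] := leqP j 1.
  have -> : gaps j = 0%N by rewrite e1; have -> : j.-1 = 0%N by lia.
  by split; lia.
have ej1 : j.-1 = (j - 2).+1 by lia.
have [c2|nc2] := boolP (c (j - 2)%N).
  have e2 : gaps j = gaps (j - 2)%N by rewrite e1 ej1 gapsS c2 addn0.
  have [|le _] := IH (j - 2)%N _ c2; first by lia.
  by rewrite e2; split; lia.
have ltn : (j - 2 < n)%N by have := c_lt cj; lia.
have := c_max ltn nc2; rewrite -ej1 (negPf nc1) orbF => /andP [j2 c3].
have ej2 : (j - 2 = (j - 3).+1)%N by lia.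
have ej3 : (j - 2).-1 = (j - 3)%N by lia.
rewrite ej3 in c3.
have e3 : gaps j = (gaps (j - 3)%N).+1.
  by rewrite e1 ej1 gapsS -ej1 nc2 nc1 /= ej2 gapsS c3 addn0 addn1.
have [|le eq] := IH (j - 3)%N _ c3; first by lia.
rewrite e3; split=> [|e i ij]; first by lia.
have [le3|gt3] := leqP i (j - 3); first by apply: eq => //; lia.
have d3 : (3 %| j - 3)%N by rewrite -eq //; lia.
have [->|[->|->]] : i = (j - 2)%N \/ i = j.-1 \/ i = j by lia.
- by rewrite (negPf nc2); lia.
- by rewrite (negPf nc1); lia.
- by rewrite cj; lia.
Qed.

(** If the last vertex is chosen, apply [gaps_le] to it; otherwise the one before it is chosen, no
    gap follows, and one more vertex is to spare. *)
Lemma gaps_dichotomy : (0 < n)%N ->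
  (3 * gaps n.-1 + 2 <= n)%N \/
  n = (3 * gaps n.-1 + 1)%N /\ forall i, (i < n)%N -> c i = (3 %| i)%N.
Proof.
move=> n0; have [cn|ncn] := boolP (c n.-1).
  have [le eq] := gaps_le cn.
  have [e|ne] := eqVneq (3 * gaps n.-1)%N n.-1; last by left; move/eqP: ne => ne; lia.
  by right; split=> [|i hi]; [lia | apply: eq => //; lia].
left; have ltn : (n.-1 < n)%N by lia.
have nc : ~~ c n.-1.+1 by apply/negP => /c_lt; lia.
have := c_max ltn ncn; rewrite (negPf nc) orbF => /andP [n1 c2].
have [le _] := gaps_le c2.
by rewrite -(prednK n1) gapsS c2 addn0; lia.
Qed.

End MaximalIndependentSetsOfPaths.

(** * The suspension of a path and its induced matching *)

Section SuspendedPath.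

Variables (n : nat) (C : {set 'I_n}).

(** [C] as a predicate on all naturals, false from n on, so that successors and predecessors need no
    range proofs. *)
Definition in_set_nat (i : nat) : bool := [exists x : 'I_n, (x == i :> nat) && (x \in C)].
Local Notation c := in_set_nat.
Local Notation e := (suspension (@path_graph n) C).
Local Notation z := (ord_max : 'I_n.+1).

Lemma in_set_natE (x : 'I_n) : c x = (x \in C).
Proof.
apply/existsP/idP => [[y /andP [/eqP /ord_inj -> //]]|h].
by exists x; rewrite eqxx.
Qed.

Lemma in_set_nat_lt i : c i -> (i < n)%N.
Proof. by move=> /existsP [x /andP [/eqP <- _]]. Qed.

Lemma suspensionE (u v : 'I_n.+1) : e u v =
  [|| [&& (v == u.+1 :> nat) || (u == v.+1 :> nat), (u < n)%N & (v < n)%N],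
      (u == n :> nat) && c v | (v == n :> nat) && c u].
Proof.
have cn : c n = false by apply/negbTE/negP => /in_set_nat_lt; rewrite ltnn.
have ne (i : 'I_n) : (i == n :> nat) = false by have := ltn_ord i; lia.
rewrite /suspension; case: (unliftP ord_max u) => [i|] ->;
  case: (unliftP ord_max v) => [j|] ->; rewrite ?lift_max ?eqxx ?ne ?in_set_natE ?cn //=.
- by rewrite !ltn_ord /path_graph !orbF !andbT.
- by rewrite ltnn !andbF.
- by rewrite ltnn !andbF orbF.
- by rewrite ltnn !andbF.
Qed.

Lemma suspension_sym : ssrbool.symmetric e.
Proof.
move=> u v; rewrite !suspensionE.
by rewrite [(v == u.+1 :> nat) || _]orbC [(u < n)%N && _]andbC [X in _ || X]orbC.
Qed.

Lemma suspension_irr : irreflexive e.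
Proof.
move=> u; rewrite suspensionE orbb.
have : ~~ ((u == n :> nat) && c u).
  by apply/negP => /andP [/eqP -> /in_set_nat_lt]; rewrite ltnn.
by move=> /negPf ->; rewrite !orbF; lia.
Qed.

Lemma in_apex_neighbours u : (u \in neighbours e z) = c u.
Proof.
have cn : c n = false by apply/negbTE/negP => /in_set_nat_lt; rewrite ltnn.
by rewrite inE suspensionE /= eqxx cn ltnn !andbF !orbF.
Qed.

Lemma card_apex_neighbours : #|neighbours e z| = #|C|.
Proof.
have -> : neighbours e z = lift ord_max @: C.
  apply/setP => u; rewrite in_apex_neighbours; apply/idP/imsetP => [|[x xC ->]].
    by move=> /existsP [x /andP [/eqP xu xC]]; exists x => //; apply/ord_inj; rewrite lift_max xu.
  by rewrite lift_max in_set_natE.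
by rewrite card_imset //; apply: lift_inj.
Qed.

Hypothesis maxC : maxset (independent (@path_graph n)) C.

Lemma in_set_nat_indep i : c i -> ~~ c i.+1.
Proof.
have ind := maxsetp maxC.
move=> /existsP [x /andP [/eqP xi xC]]; apply/negP => /existsP [y /andP [/eqP yi yC]].
move/forall_inP: ind => /(_ x xC) /forall_inP /(_ y yC) /negP; apply.
by rewrite /path_graph xi yi eqxx.
Qed.

Lemma in_set_nat_max i : (i < n)%N -> ~~ c i -> ((0 < i)%N && c i.-1) || c i.+1.
Proof.
move=> hi; apply: contraR; rewrite negb_or negb_and -leqNgt leqn0 => /andP [h1 h2].
pose x := Ordinal hi; rewrite -[i]/(nat_of_ord x) in_set_natE.
have /maxsetP [ind max] := maxC.
have nx y : y \in C -> ~~ path_graph x y /\ ~~ path_graph y x.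
  move=> yC; rewrite /path_graph /=.
  have yi : y != i.+1 :> nat by apply: contraNneq h2 => <-; rewrite in_set_natE.
  have iy : i != y.+1 :> nat.
    apply: contraTneq h1 => ->; rewrite negb_or /= negbK; apply/existsP.
    by exists y; rewrite eqxx.
  by rewrite orbC (negPf yi) (negPf iy).
(* With neither neighbour of [x] in [C], adding [x] keeps the set independent, so maximality puts
   [x] in [C]. *)
rewrite -(max (x |: C)) ?setU11 ?subsetUr //.
apply/forall_inP => a; rewrite !inE => ha; apply/forall_inP => b; rewrite !inE => hb.
case/orP: ha => [/eqP ->|aC]; case/orP: hb => [/eqP ->|bC].
- by rewrite /path_graph orbb -[nat_of_ord x]/i; lia.
- by have [] := nx b bC.
- by have [] := nx a aC.
- by move/forall_inP: ind => /(_ a aC) /forall_inP /(_ b bC).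
Qed.

(** A path vertex outside [C] has a neighbour in [C] by maximality, hence at most one outside; the
    apex is adjacent only to [C]. *)
Lemma matching_outside_apex (i j l : 'I_n.+1) :
  i \notin neighbours e z -> j \notin neighbours e z -> l \notin neighbours e z ->
  e i j -> e i l -> j = l.
Proof.
rewrite !in_apex_neighbours !suspensionE => ci cj cl.
rewrite (negPf ci) (negPf cj) (negPf cl) !andbF !orbF.
move=> /and3P [h1 h2 h3] /and3P [h4 _ h5]; apply/ord_inj.
have := in_set_nat_max h2 ci.
have [//|ne] := eqVneq (j : nat) l.
have [[ej el]|[ej el]] : (j = i.+1 :> nat /\ l = i.-1 :> nat) \/
    (j = i.-1 :> nat /\ l = i.+1 :> nat) by lia.
- by rewrite -ej -el (negPf cj) (negPf cl) andbF.
- by rewrite -ej -el (negPf cj) (negPf cl) andbF.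
Qed.

Hypothesis n0 : (0 < n)%N.

Lemma card_edge_sources_apex : #|edge_sources e (neighbours e z)| = gaps c n.-1.
Proof.
pose gp (i : nat) := [&& i.+1 < n, ~~ c i & ~~ c i.+1]%N.
have E (u : 'I_n.+1) : (u \in edge_sources e (neighbours e z)) = gp u.
  rewrite inE in_apex_neighbours /gp; have [cu|ncu] := boolP (c u); first by rewrite andbF.
  rewrite /=; apply/existsP/andP => [[v /and3P []]|[un cu]].
    rewrite in_apex_neighbours suspensionE (negPf ncu) => /[dup] cv /negPf -> uv.
    rewrite !andbF !orbF => /and3P [h1 h2 h3].
    have ev : v = u.+1 :> nat by lia.
    by rewrite -ev.
  have lt : (u.+1 < n.+1)%N by lia.
  exists (Ordinal lt); rewrite in_apex_neighbours suspensionE /= cu eqxx un.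
  by rewrite ltnSn (ltnW un).
rewrite -sum1_card big_mkcond /= (eq_bigr (fun u : 'I_n.+1 => (gp u : nat))); last first.
  by move=> u _; rewrite E; case: (gp u).
have en : n = n.-1.+1 by rewrite prednK.
(* The indices n - 1 and n contribute nothing, which leaves the n - 1 terms of [gaps]. *)
rewrite [n in LHS]en !big_ord_recr /= /gp -en ltnn /= [(n.+1 < n)%N]ltnNge leqnSn /= !addn0.
apply: eq_bigr => i _; congr nat_of_bool.
have -> // : (i.+1 < n)%N by have := ltn_ord i; lia.
Qed.

End SuspendedPath.

(** * Regularity of paths and of their suspensions *)

Section Regularity.

Variable k : fieldType.

Lemma reg_edge_ideal n (e : rel 'I_n) r : irreflexive e ->
  attains (@graph_ideal k n e set0) r -> reg_quotient (@edge_ideal k n e) = r%:Z.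
Proof.
move=> irr h; have eE p := edge_idealE p irr.
apply: reg_quotient_attains.
- have hI := graph_ideal_homog k e set0; split.
  + exact/eE/(ideal0 hI).
  + by move=> p q /eE hp /eE hq; apply/eE/(idealD hI).
  + by move=> p q /eE hq; apply/eE/(idealM hI).
  + by move=> a b p /eE hp; apply/eE/(ideal_hcomp hI).
- by move=> p /eE; apply: graph_ideal_proper.
- by apply: attains_ext h => p; split=> /eE.
Qed.

Lemma path_sym n : ssrbool.symmetric (@path_graph n).
Proof. by move=> i j; rewrite /path_graph orbC. Qed.

Lemma path_irr n : irreflexive (@path_graph n).
Proof. by move=> i; rewrite /path_graph; lia. Qed.

Lemma reg_path n : reg_quotient (@edge_ideal k n (@path_graph n)) = (n.+1 %/ 3)%:Z.
Proof.
apply: reg_edge_ideal; first exact: path_irr.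
apply: (corner_attains (p := 2 * n %/ 3 + #|(set0 : {set 'I_n})|)%N).
apply: (gcorner_path k (@path_sym n) (@path_irr n) (leqnn n)) => [i|i j _ _].
  by rewrite inE.
by rewrite !ltn_ord !andbT.
Qed.

Variables (n : nat) (C : {set 'I_n}).
Hypothesis n0 : (0 < n)%N.
Hypothesis maxC : maxset (independent (@path_graph n)) C.
Local Notation e := (suspension (@path_graph n) C).

Lemma corner_apex_deleted :
  corner (@graph_ideal k n.+1 e (ord_max |: set0)) (2 * n %/ 3 + 1) (n.+1 %/ 3).
Proof.
rewrite setU0; suff: corner (@graph_ideal k n.+1 e [set ord_max])
    (2 * n %/ 3 + #|[set (ord_max : 'I_n.+1)]|) (n.+1 %/ 3) by rewrite cards1.
apply: (gcorner_path k (suspension_sym C) (suspension_irr C) (leqnSn n)).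
  by move=> i hi; rewrite inE -val_eqE /= neq_ltn hi.
have lt (u : 'I_n.+1) : u \notin [set ord_max] -> (u == n :> nat) = false.
  by rewrite inE -val_eqE => /negPf.
by move=> i j /lt hi /lt hj; rewrite suspensionE hi hj !orbF.
Qed.

Lemma corner_apex_colon (g := gaps (in_set_nat C) n.-1) :
  corner (@graph_ideal k n.+1 e (set0 :|: neighbours e ord_max)) (#|C| + g) g.
Proof.
rewrite set0U /g -(card_edge_sources_apex maxC n0) -(card_apex_neighbours C).
apply: gcorner_matching.
- exact: suspension_sym.
- exact: suspension_irr.
- exact: matching_outside_apex.
Qed.

Lemma reg_suspension_generic : ~ exceptional C ->
  reg_quotient (@edge_ideal k n.+1 e) = (n.+1 %/ 3)%:Z.
Proof.
move=> nex; apply: reg_edge_ideal; first exact: suspension_irr.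
have hz : (ord_max : 'I_n.+1) \notin set0 by rewrite inE.
apply: (attains_graph_adjoin (suspension_sym C) (suspension_irr C) hz _
  corner_apex_colon corner_apex_deleted).
(* The bound 3g + 2 <= n gives g < floor((n+1)/3), the strict inequality that protects the corner of
   the path; the other alternative is the exceptional case. *)
have [le|[en cE]] := gaps_dichotomy (@in_set_nat_lt _ C) (in_set_nat_indep maxC)
  (in_set_nat_max maxC) n0; first by lia.
case: nex; exists (gaps (in_set_nat C) n.-1); split=> //.
by apply/setP => i; rewrite inE -cE ?in_set_natE.
Qed.

Lemma reg_suspension_exceptional : exceptional C ->
  reg_quotient (@edge_ideal k n.+1 e) = (n.+1 %/ 3).+1%:Z.
Proof.
move=> [q [en eC]].
have cE i : (i < n)%N -> in_set_nat C i = (3 %| i)%N.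
  by move=> hi; rewrite -[i]/(nat_of_ord (Ordinal hi)) in_set_natE eC inE.
have gE : gaps (in_set_nat C) n.-1 = q.
  have -> : n.-1 = (3 * q)%N by lia.
  have : (3 * q < n)%N by lia.
  elim: q {en eC} => [|q IH] hq; first by rewrite /gaps muln0 big_ord0.
  have -> : (3 * q.+1 = (3 * q).+3)%N by lia.
  rewrite !gapsS IH ?cE; lia.
have cardC : #|C| = q.+1.
  rewrite eC -sum1_card big_mkcond /= en addn1.
  rewrite (eq_bigr (fun i : 'I_(3 * q).+1 => ((3 %| i)%N : nat))); last first.
    by move=> i _; rewrite inE; case: (3 %| i)%N.
  elim: q {en eC gE} => [|q IH]; first by rewrite big_ord_recr big_ord0.
  have -> : (3 * q.+1 = (3 * q).+3)%N by lia.
  rewrite !big_ord_recr /= in IH *; lia.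
apply: reg_edge_ideal; first exact: suspension_irr.
have hz : (ord_max : 'I_n.+1) \notin set0 by rewrite inE.
apply: corner_attains.
have -> : (n.+1 %/ 3 = q)%N by lia.
(* With n = 3q + 1 the colon corner has length |C| + q = 2q + 1, equal to floor(2n/3) + 1 for the
   deleted apex, so it lies in the top position and raises the regularity to q + 1. *)
have := corner_apex_colon; rewrite gE cardC => cc.
by apply: (gcorner_colon (suspension_sym C) (suspension_irr C) hz _ _ cc corner_apex_deleted);
  lia.
Qed.

End Regularity.

Theorem theorem5p3 (k : fieldType) (n : nat) (C : {set 'I_n}) :
  (1 <= n)%N ->
  maxset (independent (@path_graph n)) C ->
  (~ exceptional C ->
     reg_quotient (@edge_ideal k n.+1 (suspension (@path_graph n) C))
     = reg_quotient (@edge_ideal k n (@path_graph n))) /\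
  (exceptional C ->
     reg_quotient (@edge_ideal k n.+1 (suspension (@path_graph n) C))
     = reg_quotient (@edge_ideal k n (@path_graph n)) + 1).
Proof.
move=> n0 maxC; rewrite reg_path; split=> [nex|ex].
  exact: reg_suspension_generic.
by rewrite reg_suspension_exceptional // -addn1 PoszD.
Qed.
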